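(* Let $(M,\phi_\alpha,\xi_\alpha,\eta_\alpha,g)$, $\alpha\in\{1,2,3\}$, be a $3$-quasi-Sasakian manifold of dimension $4n+3$ whose rank is $4l+1$ for some $0\le l\le n$. Then $M$ is $3$-cosymplectic.
   Context: Conventions: for a $1$-form $\eta$, $2d\eta(X,Y)=X(\eta(Y))-Y(\eta(X))-\eta([X,Y])$; for a $2$-form $\Phi$, $3d\Phi(X,Y,Z)$ is the usual Cartan expression $X(\Phi(Y,Z))+Y(\Phi(Z,X))+Z(\Phi(X,Y))-\Phi([X,Y],Z)-\Phi([Y,Z],X)-\Phi([Z,X],Y)$. An almost contact metric structure $(\phi,\xi,\eta,g)$ consists of a $(1,1)$-tensor $\phi$, a vector field $\xi$ (Reeb vector field), a $1$-form $\eta$ and a Riemannian metric $g$ with $\phi^2=-I+\eta\otimes\xi$, $\eta(\xi)=1$, $g(\phi X,\phi Y)=g(X,Y)-\eta(X)\eta(Y)$. Its fundamental $2$-form is $\Phi(X,Y)=g(X,\phi Y)$. It is normal if $[\phi,\phi]+2d\eta\otimes\xi=0$ ($[\phi,\phi]$ the Nijenhuis torsion), quasi-Sasakian if it is normal and $d\Phi=0$, and cosymplectic if it is normal, $d\Phi=0$ and $d\eta=0$. A quasi-Sasakian structure has rank $2p+1$ if $\eta\wedge(d\eta)^p\neq0$ and $(d\eta)^{p+1}=0$ on $M$; only structures of constant rank are considered. An almost $3$-contact metric manifold is a $(4n+3)$-dimensional manifold with three almost contact metric structures $(\phi_\alpha,\xi_\alpha,\eta_\alpha,g)$, $\alpha=1,2,3$,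 with the same metric $g$, such that for every even permutation $(\alpha,\beta,\gamma)$ of $\{1,2,3\}$: $\phi_\gamma=\phi_\alpha\phi_\beta-\eta_\beta\otimes\xi_\alpha=-\phi_\beta\phi_\alpha+\eta_\alpha\otimes\xi_\beta$, $\xi_\gamma=\phi_\alpha\xi_\beta=-\phi_\beta\xi_\alpha$, $\eta_\gamma=\eta_\alpha\circ\phi_\beta=-\eta_\beta\circ\phi_\alpha$. It is $3$-quasi-Sasakian (respectively $3$-cosymplectic) if each of the three structures is quasi-Sasakian (respectively cosymplectic). On a $3$-quasi-Sasakian manifold it is known that there is $c\in\mathbb{R}$ with $[\xi_\alpha,\xi_\beta]=c\,\xi_\gamma$ for every even permutation, and that $\eta_1,\eta_2,\eta_3$ have the same rank, called the rank of $M$; it is of the form $4l+1$ if $c=0$ and $4l+3$ if $c\ne0$, for some $0\le l\le n$. *)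

(* Defs.v *)
From HB Require Import structures.
From mathcomp Require Import all_boot all_order all_algebra all_fingroup.
From mathcomp Require Import all_classical all_reals all_analysis ring.
Import Order.TTheory GRing.Theory Num.Theory.
Import numFieldNormedType.Exports.

Set Implicit Arguments.
Unset Strict Implicit.
Unset Printing Implicit Defensive.

Local Open Scope classical_set_scope.
Local Open Scope ring_scope.

Section EuclideanSmoothness.
Context {R : realType} {m : nat}.
Implicit Types (U : set 'rV[R]_m) (f g : 'rV[R]_m -> R).

Definition continuous_at_points U f := forall x, U x -> {for x, continuous f}.

(* For an open set U: f is C^k on U, i.e. all its iterated partial derivatives
   of order at most k exist and are continuous on U. *)
Fixpoint Ck (k : nat) U f : Prop :=
  match k with
  | 0 => continuous_at_points U f
  | k'.+1 => continuous_at_points U f /\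
      forall i : 'I_m, (forall x, U x -> derivable f x (delta_mx 0 i)) /\
                       Ck k' U ('D_(delta_mx 0 i) f)
  end.

Definition Cinfty U f := forall k, Ck k U f.

Lemma open_near_eq U f g x : open U -> (forall y, U y -> f y = g y) -> U x ->
  {near x, f =1 g}.
Proof.
move=> oU fg Ux; have : nbhs x U by exact: open_nbhs_nbhs.
exact: (@filterS _ (nbhs x)) fg.
Qed.

Lemma Ck_continuous k U f : Ck k U f -> continuous_at_points U f.
Proof. by case: k => //= k []. Qed.

Lemma Ck_pred k U f : Ck k.+1 U f -> Ck k U f.
Proof.
elim: k f => [|k IHk] f; first by case.
move=> [cf df]; split=> // i; have [dfi Cf] := df i; split=> //.
exact: IHk.
Qed.

Lemma Ck_ext k U f g : open U -> (forall y, U y -> f y = g y) ->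
  Ck k U f -> Ck k U g.
Proof.
move=> oU; have cont f' g' : (forall y, U y -> f' y = g' y) ->
    continuous_at_points U f' -> continuous_at_points U g'.
  move=> fg cf x Ux; rewrite /prop_for /continuous_at /= -(fg x Ux).
  apply: cvg_trans (cf x Ux).
  exact: (@near_eq_cvg _ _ (nbhs x) (nbhs_filter x) _ _ (open_near_eq oU fg Ux)).
elim: k f g => [|k IHk] f g fg; first exact: cont.
move=> [cf df]; split; first exact: cont cf.
move=> i; have [dfi Cf] := df i; split.
  by move=> x Ux; apply: near_eq_derivable (dfi x Ux); exact: (open_near_eq oU fg Ux).
by apply: IHk Cf => x Ux; apply: near_eq_derive; exact: (open_near_eq oU fg Ux).
Qed.

Lemma Ck_cst k U (a : R) : open U -> Ck k U (cst a).
Proof.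
move=> oU; elim: k a => [|k IHk] a; first by move=> x _; exact: cst_continuous.
split=> [x _|i]; first exact: cst_continuous.
split=> [x _|]; first exact: derivable_cst.
by apply: (Ck_ext oU _ (IHk 0)) => x _; rewrite derive_cst.
Qed.

Lemma Ck_add k U f g : open U -> Ck k U f -> Ck k U g -> Ck k U (f + g).
Proof.
move=> oU; elim: k f g => [|k IHk] f g.
  by move=> cf cg x Ux; exact: (continuousD (cf x Ux) (cg x Ux)).
move=> [cf df] [cg dg]; split=> [x Ux|i].
  exact: (continuousD (cf x Ux) (cg x Ux)).
have [dfi Cf] := df i; have [dgi Cg] := dg i; split=> [x Ux|].
  by apply: derivableD; [exact: dfi|exact: dgi].
apply: (Ck_ext oU _ (IHk _ _ Cf Cg)) => x Ux.
by rewrite deriveD //; [exact: dfi|exact: dgi].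
Qed.

Lemma Ck_mul k U f g : open U -> Ck k U f -> Ck k U g -> Ck k U (f * g).
Proof.
move=> oU; elim: k f g => [|k IHk] f g.
  by move=> cf cg x Ux; exact: (continuousM (cf x Ux) (cg x Ux)).
move=> Ckf Ckg; have Ckf' := Ck_pred Ckf; have Ckg' := Ck_pred Ckg.
case: Ckf Ckg => cf df [cg dg]; split=> [x Ux|i].
  exact: (continuousM (cf x Ux) (cg x Ux)).
have [dfi Cf] := df i; have [dgi Cg] := dg i; split=> [x Ux|].
  by apply: derivableM; [exact: dfi|exact: dgi].
apply: (Ck_ext oU _ (Ck_add oU (IHk _ _ Ckf' Cg) (IHk _ _ Ckg' Cf))) => x Ux.
by rewrite deriveM //; [exact: dfi|exact: dgi].
Qed.

End EuclideanSmoothness.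

(* chart_map and chart_inv are total functions; only their restrictions to
   chart_dom and to the image of chart_dom are meaningful. *)
Record chart (R : realType) (T : topologicalType) (m : nat) := Chart {
  chart_dom : set T;
  chart_map : T -> 'rV[R]_m;
  chart_inv : 'rV[R]_m -> T;
  chart_dom_open : open chart_dom;
  chart_cod_open : open (chart_map @` chart_dom);
  chart_mapK : {in chart_dom, cancel chart_map chart_inv};
  chart_map_continuous :
    forall p, chart_dom p -> {for p, continuous chart_map};
  chart_inv_continuous :
    forall x, (chart_map @` chart_dom) x -> {for x, continuous chart_inv}
}.

Definition chart_cod (R : realType) (T : topologicalType) (m : nat)
  (c : chart R T m) : set 'rV[R]_m := chart_map c @` chart_dom c.

Record smoothManifold (R : realType) (m : nat) := SmoothManifold {
  mfd_carrier :> topologicalType;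
  mfd_hausdorff : hausdorff_space mfd_carrier;
  mfd_second_countable : @second_countable mfd_carrier;
  atlas : set (chart R mfd_carrier m);
  atlas_cover : forall p, exists2 c, atlas c & chart_dom c p;
  atlas_smooth : forall c d, atlas c -> atlas d -> forall i : 'I_m,
    Cinfty (chart_map c @` (chart_dom c `&` chart_dom d))
           (fun x => chart_map d (chart_inv c x) 0 i)
}.

Section SmoothFunctions.
Context {R : realType} {m : nat} (M : smoothManifold R m).

Definition smooth (f : M -> R) : Prop :=
  forall c, atlas c -> Cinfty (chart_cod c) (f \o chart_inv c).

Definition smooth_pred : {pred M -> R} := fun f => `[< smooth f >].

Lemma smooth_predP f : reflect (smooth f) (f \in smooth_pred).
Proof. exact: asboolP. Qed.

Lemma smooth_cst (a : R) : smooth (cst a).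
Proof. by move=> c _ k; apply: Ck_cst; exact: chart_cod_open. Qed.

Lemma smooth_add (f g : M -> R) : smooth f -> smooth g -> smooth (f + g).
Proof.
by move=> sf sg c ac k; apply: Ck_add;
  [exact: chart_cod_open|exact: sf|exact: sg].
Qed.

Lemma smooth_mul (f g : M -> R) : smooth f -> smooth g -> smooth (f * g).
Proof.
by move=> sf sg c ac k; apply: Ck_mul;
  [exact: chart_cod_open|exact: sf|exact: sg].
Qed.

Lemma smooth_scale (a : R) (f : M -> R) : smooth f -> smooth (a *: f).
Proof. exact/smooth_mul/smooth_cst. Qed.

Lemma smooth_sub (f g : M -> R) : smooth f -> smooth g -> smooth (f - g).
Proof.
by move=> sf sg; apply: smooth_add => //; rewrite -scaleN1r; exact: smooth_scale.
Qed.

Lemma smooth_subring : subring_closed smooth_pred.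
Proof.
split=> [|f g|f g]; first exact/smooth_predP/(smooth_cst 1).
- by move=> /smooth_predP sf /smooth_predP sg; exact/smooth_predP/smooth_sub.
- by move=> /smooth_predP sf /smooth_predP sg; exact/smooth_predP/smooth_mul.
Qed.
HB.instance Definition _ :=
  GRing.isSubringClosed.Build (M -> R) smooth_pred smooth_subring.

Lemma smooth_scaler : scaler_closed smooth_pred.
Proof.
by move=> a f /smooth_predP sf; exact/smooth_predP/smooth_scale.
Qed.
HB.instance Definition _ :=
  GRing.isScaleClosed.Build R (M -> R) smooth_pred smooth_scaler.

Record Csmooth := CSmooth { Csmooth_fun :> M -> R;
                            Csmooth_subproof : Csmooth_fun \in smooth_pred }.
HB.instance Definition _ := [isSub for Csmooth_fun].
HB.instance Definition _ := [Choice of Csmooth by <:].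
HB.instance Definition _ := 
  GRing.SubChoice_isSubComPzRing.Build (M -> R) smooth_pred Csmooth smooth_subring.
HB.instance Definition _ := [SubZmodule_isSubLmodule of Csmooth by <:].

Definition mkCsmooth (f : M -> R) (sf : smooth f) : Csmooth :=
  CSmooth (introT (smooth_predP f) sf).

Lemma Csmooth_smooth (f : Csmooth) : smooth f.
Proof. exact/smooth_predP/Csmooth_subproof. Qed.

End SmoothFunctions.

Section TangentSpace.
Context {R : realType} {m : nat} {M : smoothManifold R m} (p : M).
Local Notation C := (Csmooth M).

(* The tangent space at p is the space of derivations at p of the algebra of
   smooth functions on M. *)
Definition derivation_at (v : C -> R) : Prop :=
  [/\ forall f g, v (f + g) = v f + v g,
      forall (a : R) f, v (a *: f) = a * v f
    & forall f g, v (f * g) = v f * g p + f p * v g].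

Definition derivation_pred : {pred C -> R} := fun v => `[< derivation_at v >].

Lemma derivation_predP v : reflect (derivation_at v) (v \in derivation_pred).
Proof. exact: asboolP. Qed.

Lemma derivation_submod : submod_closed derivation_pred.
Proof.
split=> [|a u v /derivation_predP[uD uZ uM] /derivation_predP[vD vZ vM]].
  by apply/derivation_predP; split=> *; rewrite /= ?addr0 ?mulr0 ?mul0r ?addr0.
have E w : (a *: u + v) w = a * u w + v w by [].
apply/derivation_predP; split=> [f g|b f|f g]; rewrite !E.
- by rewrite uD vD; ring.
- by rewrite uZ vZ; ring.
- by rewrite uM vM; ring.
Qed.
HB.instance Definition _ :=
  GRing.isSubmodClosed.Build R (C -> R) derivation_pred derivation_submod.

Record tangent := Tangent {
  tangent_fun :> C -> R;
  tangent_subproof : tangent_fun \in derivation_pred }.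
HB.instance Definition _ := [isSub for tangent_fun].
HB.instance Definition _ := [Choice of tangent by <:].
HB.instance Definition _ := [SubChoice_isSubLmodule of tangent by <:].

Definition mkTangent (v : C -> R) (dv : derivation_at v) : tangent :=
  Tangent (introT (derivation_predP v) dv).

Lemma tangent_derivation (v : tangent) : derivation_at v.
Proof. exact/derivation_predP/tangent_subproof. Qed.

End TangentSpace.

Arguments tangent {R m M} p.

Section Tensors.
Context {R : realType} {m : nat} (M : smoothManifold R m).

(* Tensor fields are families of tensors on the tangent spaces.  Since M is
   Hausdorff and second countable, such a family is smooth as soon as it sends
   globally defined smooth functions and vector fields to smooth ones. *)
Record vfield := VField {
  vfield_fun :> forall p : M, tangent p;
  vfield_smooth : forall f : Csmooth M, smooth (fun p => vfield_fun p f) }.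

Record one_form := OneForm {
  one_form_fun :> forall p : M, {scalar (tangent p)};
  one_form_smooth : forall X : vfield, smooth (fun p => one_form_fun p (X p)) }.

Record endo_field := EndoField {
  endo_field_fun :> forall p : M, {linear (tangent p) -> (tangent p)};
  endo_field_smooth : forall (X : vfield) (f : Csmooth M),
    smooth (fun p => endo_field_fun p (X p) f) }.

Record riem_metric := RiemMetric {
  metric_fun :> forall p : M, tangent p -> tangent p -> R;
  riem_sym : forall p (u v : tangent p), metric_fun u v = metric_fun v u;
  riem_linear : forall p (u : tangent p), scalar (metric_fun u);
  riem_pos : forall p (u : tangent p), u != 0 -> 0 < metric_fun u u;
  riem_smooth : forall X Y : vfield,
    smooth (fun p => metric_fun (X p) (Y p)) }.

End Tensors.

Section Operations.
Context {R : realType} {m : nat} {M : smoothManifold R m}.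
Implicit Types (X Y Z : vfield M) (f : Csmooth M).

Definition vact X f : Csmooth M := mkCsmooth (vfield_smooth X f).

Definition eval1 (eta : one_form M) X : Csmooth M :=
  mkCsmooth (one_form_smooth eta X).

Definition endo_app (phi : endo_field M) X : vfield M :=
  @VField R m M (fun p => phi p (X p)) (endo_field_smooth phi X).

Lemma lie_derivation X Y (p : M) :
  derivation_at p (fun f => X p (vact Y f) - Y p (vact X f)).
Proof.
have [XD XZ XM] := tangent_derivation (X p).
have [YD YZ YM] := tangent_derivation (Y p).
have vD W f g : vact W (f + g) = vact W f + vact W g.
  apply/val_inj/funext => q.
  by have [WD _ _] := tangent_derivation (W q); exact: WD.
have vZ W a f : vact W (a *: f) = a *: vact W f.
  apply/val_inj/funext => q.
  by have [_ WZ _] := tangent_derivation (W q); exact: WZ.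
have vM W f g : vact W (f * g) = vact W f * g + f * vact W g.
  apply/val_inj/funext => q.
  by have [_ _ WM] := tangent_derivation (W q); exact: WM.
split=> [f g|a f|f g].
- by rewrite !vD XD YD opprD addrACA.
- by rewrite !vZ XZ YZ mulrBr.
- rewrite !vM XD YD !XM !YM /=; ring.
Qed.

Lemma lie_smooth X Y f :
  smooth (fun p => X p (vact Y f) - Y p (vact X f)).
Proof. by apply: smooth_sub; exact: vfield_smooth. Qed.

Definition lie X Y : vfield M :=
  @VField R m M (fun p => mkTangent (lie_derivation X Y p)) (lie_smooth X Y).

Definition d1 (eta : one_form M) X Y (p : M) : R :=
  2^-1 * (X p (eval1 eta Y) - Y p (eval1 eta X) - eval1 eta (lie X Y) p).

Definition d2 (w : vfield M -> vfield M -> Csmooth M) X Y Z (p : M) : R :=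
  3^-1 * (X p (w Y Z) + Y p (w Z X) + Z p (w X Y)
          - w (lie X Y) Z p - w (lie Y Z) X p - w (lie Z X) Y p).

Definition fund_form (g : riem_metric M) (phi : endo_field M) X Y : Csmooth M :=
  mkCsmooth (riem_smooth g X (endo_app phi Y)).

Definition nijenhuis (phi : endo_field M) X Y (p : M) : tangent p :=
  phi p (phi p (lie X Y p)) + lie (endo_app phi X) (endo_app phi Y) p
  - phi p (lie (endo_app phi X) Y p) - phi p (lie X (endo_app phi Y) p).

End Operations.

Section ExteriorPowers.
Context {R : realType} {m : nat} (M : smoothManifold R m).

(* Only the values of a k-form on k vector fields are recorded; the operations
   below are applied to alternating, tensorial arguments only. *)
Definition kform (k : nat) := ('I_k -> vfield M) -> M -> R.

(* The normalisation of the wedge product is the one that goes with the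
   factors 2 and 3 in d1 and d2. *)
Definition wedge (j k : nat) (a : kform j) (b : kform k) : kform (j + k) :=
  fun X p => ((j + k)`!%:R)^-1 *
    \sum_(s : 'S_(j + k)) (-1) ^+ s * a (fun i => X (s (lshift k i))) p
                                    * b (fun i => X (s (rshift j i))) p.

Fixpoint wedge_pow (w : kform 2) (k : nat) : kform (k * 2) :=
  match k return kform (k * 2) with
  | 0 => fun _ _ => 1
  | k'.+1 => wedge w (@wedge_pow w k')
  end.
Arguments wedge_pow w k X p : clear implicits.

Definition kform_of_1 (eta : one_form M) : kform 1 :=
  fun X p => eval1 eta (X 0) p.

Definition kform_d1 (eta : one_form M) : kform 2 :=
  fun X p => d1 eta (X 0) (X 1) p.

Definition kform_nowhere0 (k : nat) (a : kform k) : Prop :=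
  forall p, exists X, a X p <> 0.

Definition kform_eq0 (k : nat) (a : kform k) : Prop := forall X p, a X p = 0.

Definition has_rank (eta : one_form M) (r : nat) : Prop :=
  exists q : nat, [/\ r = (2 * q + 1)%N,
    kform_nowhere0 (wedge (kform_of_1 eta) (wedge_pow (kform_d1 eta) q))
    & kform_eq0 (wedge_pow (kform_d1 eta) q.+1)].

End ExteriorPowers.

Section AlmostContact.
Context {R : realType} {m : nat} {M : smoothManifold R m}.

Definition almost_contact_metric (phi : endo_field M) (xi : vfield M)
    (eta : one_form M) (g : riem_metric M) : Prop :=
  [/\ forall p (v : tangent p), phi p (phi p v) = - v + eta p v *: xi p,
      forall p, eta p (xi p) = 1
    & forall p (u v : tangent p),
        g p (phi p u) (phi p v) = g p u v - eta p u * eta p v].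

Definition normal_structure (phi : endo_field M) (xi : vfield M) (eta : one_form M) :=
  forall X Y p, nijenhuis phi X Y p + (2 * d1 eta X Y p) *: xi p = 0.

Definition quasi_sasakian (phi : endo_field M) (xi : vfield M)
    (eta : one_form M) (g : riem_metric M) : Prop :=
  [/\ almost_contact_metric phi xi eta g, normal_structure phi xi eta
    & forall X Y Z p, d2 (fund_form g phi) X Y Z p = 0].

Definition cosymplectic (phi : endo_field M) (xi : vfield M)
    (eta : one_form M) (g : riem_metric M) : Prop :=
  [/\ almost_contact_metric phi xi eta g, normal_structure phi xi eta,
      forall X Y Z p, d2 (fund_form g phi) X Y Z p = 0
    & forall X Y p, d1 eta X Y p = 0].

End AlmostContact.

Section Almost3Contact.
Context {R : realType} {n : nat} {M : smoothManifold R (4 * n + 3)}.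
Implicit Types (phi : 'I_3 -> endo_field M) (xi : 'I_3 -> vfield M)
  (eta : 'I_3 -> one_form M) (g : riem_metric M).

(* The index set {1,2,3} is 'I_3 = {0,1,2}, and an even permutation (a, b, c)
   of it is (s 0, s 1, s 2) with s an even element of 'S_3. *)
Definition almost_3contact_metric phi xi eta g : Prop :=
  (forall a, almost_contact_metric (phi a) (xi a) (eta a) g) /\
  (forall s : 'S_3, ~~ odd_perm s ->
     let a := s 0 in let b := s 1 in let c := s 2 in
     forall p : M,
     [/\ (forall v : tangent p,
            phi c p v = phi a p (phi b p v) - eta b p v *: xi a p /\
            phi c p v = - phi b p (phi a p v) + eta a p v *: xi b p),
         xi c p = phi a p (xi b p) /\ xi c p = - phi b p (xi a p)
       & forall v : tangent p,
            eta c p v = eta a p (phi b p v) /\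
            eta c p v = - eta b p (phi a p v)]).

Definition three_quasi_sasakian phi xi eta g : Prop :=
  almost_3contact_metric phi xi eta g /\
  forall a, quasi_sasakian (phi a) (xi a) (eta a) g.

Definition three_cosymplectic phi xi eta g : Prop :=
  almost_3contact_metric phi xi eta g /\
  forall a, cosymplectic (phi a) (xi a) (eta a) g.

(* The rank of M is the common rank of the three 1-forms. *)
Definition three_rank eta (r : nat) : Prop := forall a, has_rank (eta a) r.

End Almost3Contact.

(* Main.v *)
Require Import Defs.
From HB Require Import structures.
From mathcomp Require Import all_boot all_order all_algebra all_fingroup.
From mathcomp Require Import all_classical all_reals all_analysis ring zify.
Import Order.TTheory GRing.Theory Num.Theory.

(* For (a, b, c) cyclic put T_c = L_(xi_a) phi_b.  As the Reeb fields are Killing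
   and the fundamental forms are closed, Cartan's formula gives
   2 d eta_c (X, Y) = g (X, T_c Y); this replaces the Levi-Civita connection.
   Deriving phi_c = phi_a phi_b - eta_b (x) xi_a along xi_b yields
   T_a = - T_c phi_b + eta_b (x) [xi_a, xi_b], from which [xi_a, xi_b] = k xi_c
   for one function k, and, on the horizontal distribution, T_c commutes with
   phi_c and anticommutes with phi_a and phi_b.

   Where k <> 0, the form d eta_c is therefore the orthogonal sum of a
   hyperbolic plane spanned by xi_a, xi_b and of a form that splits into
   quaternionic lines, so that its rank is 2 modulo 4, while rank 4l+1 of eta_c
   means that d eta_c has rank 4l.  Hence k = 0 and the Reeb fields commute.

   Then L_(xi_a) annihilates eta_a and eta_c, hence T_a and T_c, and deriving
   T_a = - T_c phi_b along xi_a gives T_c T_c = 0.  As T_c is skew for g, T_c = 0.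

   All of this takes place in the module of vector fields over the smooth
   functions, on which g is definite; neither the dimension of the tangent spaces
   nor the extension of tangent vectors to vector fields is needed. *)

Set Implicit Arguments.
Unset Strict Implicit.
Unset Printing Implicit Defensive.

Local Open Scope ring_scope.

(** * Wedge powers of a 2-form *)

Lemma lift_perm0_ex n (s : 'S_n.+1) : s ord0 = ord0 -> exists t, s = lift_perm ord0 ord0 t.
Proof.
move=> s0; have ne j : ord0 != s (lift ord0 j) by rewrite -{1}s0 (inj_eq perm_inj) neq_lift.
pose f j := odflt j (unlift ord0 (s (lift ord0 j))).
have fE j : lift ord0 (f j) = s (lift ord0 j).
  by rewrite /f; case: (unlift_some (ne j)) => k -> ->.
have f_inj : injective f.
  by move=> i j /(congr1 (lift ord0)); rewrite !fE => /perm_inj /lift_inj.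
exists (perm f_inj); apply/permP => i; case: (unliftP ord0 i) => [j|] ->.
  by rewrite lift_perm_lift permE fE.
by rewrite lift_perm_id.
Qed.

(* The Gram matrix of a symplectic basis in which the vectors 2i and 2i+1 are
   paired. *)
Definition std {K : pzRingType} (a b : nat) : K :=
  if a./2 == b./2 then (odd b)%:R - (odd a)%:R else 0.

Lemma stdSS (K : pzRingType) a b : std a.+2 b.+2 = std a b :> K.
Proof. by rewrite /std /= eqSS !negbK. Qed.

Section WedgePowers.
Context {R : realType} {m : nat} {M : smoothManifold R m}.
Variable p : M.
Implicit Types (j k r : nat).

Lemma wedge_perm j k (a : kform M j) (b : kform M k) (t : 'S_(j + k)) X :
  wedge a b (fun i => X (t i)) p = (-1) ^+ t * wedge a b X p.
Proof.
rewrite /wedge mulrCA; congr (_ * _); rewrite big_distrr /=.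
rewrite (reindex_inj (mulIg t^-1%g)) /=; apply: eq_bigr => s _.
have tK i : t ((s * t^-1)%g i) = s i by rewrite permM permKV.
rewrite odd_permM odd_permV signr_addb [(-1) ^+ s * _]mulrC -!mulrA.
by congr (_ * (_ * (a _ _ * b _ _))); apply: functional_extensionality_dep => i; rewrite tK.
Qed.

Section Power.
Variable w : vfield M -> vfield M -> M -> R.
Let om : kform M 2 := fun X q => w (X 0) (X 1) q.

Lemma wedge_pow_perm k (t : 'S_(k * 2)) (X : 'I_(k * 2) -> vfield M) :
  @wedge_pow R m M om k (fun i => X (t i)) p = (-1) ^+ t * @wedge_pow R m M om k X p.
Proof.
case: k t X => [|k] t X; last exact: wedge_perm.
have -> : t = 1%g by apply/permP => -[].
by rewrite odd_perm1 mul1r.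
Qed.

(** Lets an index permutation that preserves the Gram matrix act inside the power without changing
    its value. *)
Lemma wedge_pow_gram k (X Y : 'I_(k * 2) -> vfield M) :
  (forall i j : 'I_(k * 2), w (X i) (X j) p = w (Y i) (Y j) p) ->
  @wedge_pow R m M om k X p = @wedge_pow R m M om k Y p.
Proof.
elim: k X Y => [|k IHk] X Y E //=; rewrite /wedge; congr (_ * _).
have E2 (i j : 'I_(2 + k * 2)) : w (X i) (X j) p = w (Y i) (Y j) p by exact: E.
apply: eq_bigr => s _; congr (_ * _ * _); first exact: E2.
by apply: IHk => i j; exact: E2.
Qed.

Hypothesis wC : forall x y, w x y p = - w y x p.

(* Every nonzero term of the antisymmetrization is positive: s maps the first two
   indices to a pair, which an even swap of two pairs brings back to the front. *)
Lemma wedge_pow_std k (X : 'I_(k * 2) -> vfield M) :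
  (forall i j : 'I_(k * 2), w (X i) (X j) p = std i j) ->
  0 < @wedge_pow R m M om k X p.
Proof.
elim: k X => [|k IHk] X E /=; first exact: ltr01.
rewrite /wedge; apply: mulr_gt0; first by rewrite invr_gt0 ltr0n fact_gt0.
set T := BIG_F.
have ES (i j : 'I_(2 + k * 2)) : w (X i) (X j) p = std i j by exact: E.
pose Y (i : 'I_(k * 2)) := X (rshift 2 i).
have Y0 : 0 < @wedge_pow R m M om k Y p.
  by apply: IHk => i j; rewrite ES; exact: stdSS.
pose o0 : 'I_(2 + k * 2) := lshift (k * 2) 0.
pose o1 : 'I_(2 + k * 2) := lshift (k * 2) 1.
(* Such an [s] acts on the remaining indices by some [t] of the same sign, and the sign from
   [wedge_pow_perm] cancels that of [s]. *)
have fixed (s : 'S_(2 + k * 2)) : s o0 = o0 -> s o1 = o1 -> 0 < T s.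
  move=> s0 s1.
  have o0E : ord0 = o0 :> 'I_(k * 2).+2 by exact/val_inj.
  have s00 : (s : 'S_(k * 2).+2) ord0 = ord0 by rewrite o0E.
  have [t1 st1] := lift_perm0_ex s00.
  have o1E : o1 = lift ord0 ord0 by exact/val_inj.
  have t10 : t1 ord0 = ord0.
    by apply: (@lift_inj _ ord0); rewrite -(lift_perm_lift ord0 ord0) -st1 -o1E.
  have [t t1t] := lift_perm0_ex t10.
  have odd_s : odd_perm s = odd_perm t by rewrite st1 t1t !odd_lift_perm.
  have rE (i : 'I_(k * 2)) : rshift 2 i = lift ord0 (lift ord0 i) :> 'I_(k * 2).+2.
    exact/val_inj.
  rewrite /T /om -/o0 -/o1 s0 s1 ES /std /= subr0 mulr1 odd_s.
  have -> : (fun i => X (s (rshift 2 i))) = (fun i => Y (t i)).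
    apply: functional_extensionality_dep => i; rewrite /Y !rE.
    by congr X; rewrite st1 t1t !lift_perm_lift.
  by rewrite wedge_pow_perm mulrA -signr_addb addbb mul1r.
have block (s : 'S_(2 + k * 2)) : [\/ s o0 = o0 /\ s o1 = o1 | s o0 = o1 /\ s o1 = o0] -> 0 < T s.
  case=> -[s0 s1]; first exact: fixed.
  have -> : T s = T (tperm o0 o1 * s)%g.
    rewrite /T /om -/o0 -/o1 !permM tpermL tpermR wC odd_permM odd_tperm.
    rewrite (_ : o0 != o1) // signr_addb mulN1r mulrN !mulNr; congr (- (_ * _ * _)).
    congr (wedge_pow _ _ _); apply: functional_extensionality_dep => i.
    by rewrite permM tpermD.
  by apply: fixed; rewrite permM ?tpermL ?tpermR.
suff T0 (s : 'S_(2 + k * 2)) : 0 <= T s.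
  rewrite (bigD1 1%g) //=; apply: ltr_pwDl; first by apply: fixed; rewrite perm1.
  by apply: sumr_ge0 => s _.
have [Es|Es] := eqVneq (w (X (s o0)) (X (s o1)) p) 0.
  by rewrite /T /om -/o0 -/o1 Es mulr0 mul0r.
have [h [e [d [eh dh sed]]]] : exists h e d, [/\ val e = h.*2, val d = h.*2.+1 &
    [\/ s o0 = e /\ s o1 = d | s o0 = d /\ s o1 = e]].
  move: Es; rewrite ES /std; case: ifP => [/eqP hh|_]; last by rewrite eqxx.
  have Ex (i : 'I_(2 + k * 2)) : val i = (odd i + i./2.*2)%N by rewrite odd_double_half.
  have [p0|/negbTE p0] := boolP (odd (s o0)); have [p1|/negbTE p1] := boolP (odd (s o1));
    rewrite ?subrr ?eqxx // => _.
    exists (s o0)./2, (s o1), (s o0); split; last by right.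
      by rewrite Ex p1 hh.
    by rewrite Ex p0.
  exists (s o0)./2, (s o0), (s o1); split; last by left.
    by rewrite Ex p0.
  by rewrite Ex p1 hh.
rewrite /= in eh dh.
(* [f] exchanges the pairs 0 and [h], and [u] below does so on indices. [u] is even and preserves
   [std]; it is the identity when [h] is 0. *)
pose f a := if a == 0%N then h else if a == h then 0%N else a.
have f_inj a b : (f a == f b) = (a == b)
  by rewrite /f; apply/eqP/eqP => [|-> //]; case: eqP => ?; do 3?case: eqP => ?; lia.
pose u := (tperm o0 e * tperm o1 d)%g.
have ue : u e = o0.
  rewrite permM tpermR tpermD //; apply/eqP => /(congr1 val) /=; lia.
have ud : u d = o1.
  rewrite permM (@tpermD _ o0 e d) ?tpermR //; apply/eqP => /(congr1 val) /=; lia.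
have uP (i : 'I_(2 + k * 2)) : odd (u i) = odd i /\ (u i)./2 = f i./2.
  have ieq (a b : 'I_(2 + k * 2)) : a != b -> val a <> val b by move=> /eqP n /val_inj.
  rewrite /u permM; case: (tpermP o0 e i) => [->|->|/eqP/ieq i0 /eqP/ieq ie].
  - rewrite tpermD; [|by apply/eqP => /(congr1 val) /=; lia..].
    by rewrite eh /f /=; split; lia.
  - rewrite tpermD; [|by apply/eqP => /(congr1 val) /=; lia..].
    by rewrite eh doubleK odd_double /f eqxx /=; split=> //; case: eqP => [->|].
  case: tpermP => [->|->|/eqP/ieq i1 /eqP/ieq id].
  - by rewrite dh /f /=; split; lia.
  - by rewrite dh /= uphalf_double odd_double /f eqxx /=; split=> //; case: eqP => [->|].
  rewrite /= ?eh ?dh in i0 ie i1 id; rewrite /f;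
  split=> //; case: eqP => [?|_]; [lia|case: eqP => [?|//]; lia].
have std_u (i j : 'I_(2 + k * 2)) : std (u i) (u j) = std i j.
  by rewrite /std !(uP _).1 !(uP _).2 f_inj.
have -> : T s = T (s * u)%g.
  rewrite /T /om -/o0 -/o1 !(permM s u) !ES std_u (odd_permM s u) odd_permM !odd_tperm.
  have -> : (o0 != e) (+) (o1 != d) = false.
    by rewrite -!(inj_eq val_inj) /= eh dh; lia.
  rewrite addbF; congr (_ * _ * _); apply: wedge_pow_gram => i j.
  by rewrite !ES !(permM s u) std_u.
by apply/ltW/block; rewrite !(permM s u); case: sed => -[-> ->]; rewrite ue ud; [left|right].
Qed.

End Power.
End WedgePowers.

(** * Vanishing of wedge products built from few functionals *)

Section WedgeRank.
Context {R : realType} {m : nat} {M : smoothManifold R m}.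
Variables (p : M) (J : finType) (Q : J -> vfield M -> R).

(** The functionals [Q] will be the factors of a decomposition of d eta at [p]; their number bounds
    its rank. *)
Definition expandable k (a : kform M k) := exists (I : finType) (c : I -> R) (F : I -> 'I_k -> J),
  forall X, a X p = \sum_i c i * \prod_j Q (F i j) (X j).

(** The antisymmetrization is kept inside each summand, which makes every summand a multiple of a
    determinant. *)
Lemma wedge_expand j k (a : kform M j) (b : kform M k) : expandable a -> expandable b ->
  exists (I : finType) (c : I -> R) (F : I -> 'I_(j + k) -> J), forall X,
    wedge a b X p = \sum_i c i * \sum_(s : 'S_(j + k)) (-1) ^+ s * \prod_n Q (F i n) (X (s n)).
Proof.
case=> [I1 [c1 [F1 E1]]] [I2 [c2 [F2 E2]]].
pose F (i : I1 * I2) n := match fintype.split n with inl n1 => F1 i.1 n1 | inr n2 => F2 i.2 n2 end.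
exists (I1 * I2)%type, (fun i => ((j + k)`!%:R)^-1 * (c1 i.1 * c2 i.2)), F => X.
rewrite /wedge.
transitivity (((j + k)`!%:R)^-1 * \sum_(s : 'S_(j + k)) \sum_(i : I1 * I2)
    (c1 i.1 * c2 i.2) * ((-1) ^+ s * \prod_n Q (F i n) (X (s n)))).
  congr (_ * _); apply: eq_bigr => s _; rewrite E1 E2 -mulrA big_distrlr /= pair_big /=.
  rewrite big_distrr /=; apply: eq_bigr => i _.
  rewrite big_split_ord /= [RHS]mulrCA mulrACA; congr (_ * (_ * (_ * _))); apply: eq_bigr => n _.
    by rewrite /F (fintype.unsplitK (inl n)).
  by rewrite /F (fintype.unsplitK (inr n)).
rewrite exchange_big /= big_distrr /=; apply: eq_bigr => i _.
by rewrite -mulrA -big_distrr.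
Qed.

Lemma expandable_wedge j k (a : kform M j) (b : kform M k) :
  expandable a -> expandable b -> expandable (wedge a b).
Proof.
move=> ea eb; have [I [c [F E]]] := wedge_expand ea eb.
exists (I * 'S_(j + k))%type, (fun x : I * 'S_(j + k) => c x.1 * (-1) ^+ x.2),
  (fun (x : I * 'S_(j + k)) n => F x.1 ((x.2^-1)%g n)) => X.
rewrite E; under eq_bigr do rewrite big_distrr /=.
rewrite pair_big /=; apply: eq_bigr => -[i s] _ /=; rewrite mulrA; congr (_ * _).
by rewrite [RHS](reindex_inj (@perm_inj _ s)); apply: eq_bigr => n _; rewrite permK.
Qed.

(** Pigeonhole: with fewer functionals than arguments, every determinant of [wedge_expand] has two
    equal rows. *)
Lemma wedge_eq0 j k (a : kform M j) (b : kform M k) X :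
  expandable a -> expandable b -> (#|J| < j + k)%N -> wedge a b X p = 0.
Proof.
move=> ea eb ltJ; have [I [c [F ->]]] := wedge_expand ea eb.
apply: big1 => i _; set A := \matrix_(n, r) Q (F i n) (X r) : 'M[R]_(j + k).
transitivity (c i * \det A).
  by congr (_ * _); apply: eq_bigr => s _; congr (_ * _); apply: eq_bigr => n _; rewrite mxE.
have /injectivePn[n1 [n2 n12 En]] : ~~ injectiveb (F i).
  apply/negP => /injectiveP /leq_card; rewrite card_ord; lia.
by rewrite (determinant_alternate n12) ?mulr0 // => r; rewrite !mxE En.
Qed.

Lemma expandable_wedge_pow (w : kform M 2) k : expandable w -> expandable (@wedge_pow R m M w k).
Proof.
move=> ew; elim: k => [|k IHk]; last exact: (expandable_wedge ew IHk).
exists 'I_1, (fun=> 1),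
  (fun _ (n : 'I_0) => match n with Ordinal _ lt => match notF lt with end end) => X.
by rewrite /= big_ord1 mul1r big_ord0.
Qed.

Lemma wedge_pow_eq0 (w : kform M 2) k X :
  expandable w -> (#|J| < k * 2)%N -> @wedge_pow R m M w k X p = 0.
Proof.
case: k X => [|k] X ew ltJ //.
exact: wedge_eq0 ew (expandable_wedge_pow k ew) ltJ.
Qed.

End WedgeRank.

(** * Skew forms *)

Section SkewForms.
Context {K : numFieldType} {C : pzRingType} {V : lmodType C}.
Variables (ev : C -> K) (cst : K -> C).
Hypothesis cstK : cancel cst ev.
Implicit Types (w : V -> V -> K) (x y z u v : V).

(** The model is a form at one point expressed on global vector fields: [C] is the ring of smooth
    functions, [ev] the evaluation at the point, [cst] the constant functions. *)
Definition skew_form w : Prop :=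
  (forall x y, w x y = - w y x) /\
  (forall f x y z, w (f *: x + y) z = ev f * w x z + w y z).

(* If w u v = 1, this is w after the w-orthogonal projection along u and v. *)
Definition split_pair u v w x y : K := w x y - (w x v * w u y - w x u * w v y).

(** [k] hyperbolic planes split off from [w] one after the other and leave [w'], so that the rank of
    [w] is 2k plus that of [w']. *)
Inductive reduces : nat -> (V -> V -> K) -> (V -> V -> K) -> Prop :=
| reduces0 w w' : (forall x y, w x y = w' x y) -> reduces 0 w w'
| reducesS k u v w w' : w u v = 1 -> reduces k (split_pair u v w) w' -> reduces k.+1 w w'.

Lemma reduces_trans_split k u v w w' w'' : w u v = 1 ->
  (forall x y, split_pair u v w x y = w' x y) -> reduces k w' w'' -> reduces k.+1 w w''.
Proof.
move=> uv E; have -> : w' = split_pair u v w.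
  by apply: functional_extensionality_dep => x; apply: functional_extensionality_dep => y.
exact: reducesS.
Qed.

Section SkewForm.
Variable w : V -> V -> K.
Hypothesis sw : skew_form w.

Let wC x y : w x y = - w y x. Proof. by case: sw. Qed.

Lemma skew_form_diag x : w x x = 0.
Proof.
by have /eqP := wC x x; rewrite -addr_eq0 -mulr2n mulrn_eq0 /= => /eqP.
Qed.

Lemma skew_form0 y : w 0 y = 0.
Proof.
have [_ /(_ (cst 1) 0 0 y)] := sw; rewrite scaler0 addr0 cstK mul1r.
by move/(congr1 (fun t => t - w 0 y)); rewrite addrK subrr => ->.
Qed.

Lemma skew_formZ a x y : w (cst a *: x) y = a * w x y.
Proof. by have [_ L] := sw; rewrite -[cst a *: x]addr0 L cstK skew_form0 addr0. Qed.

Lemma skew_formZr a x y : w x (cst a *: y) = a * w x y.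
Proof. by rewrite wC skew_formZ wC mulrN opprK. Qed.

Lemma skew_form_comb a b x u v y :
  w (cst a *: u + (cst b *: v + x)) y = a * w u y + (b * w v y + w x y).
Proof. by have [_ L] := sw; rewrite !L !cstK. Qed.

Lemma skew_form_split u v : skew_form (split_pair u v w).
Proof.
have [_ L] := sw; rewrite /split_pair; split=> [x y|f x y z].
  rewrite (wC x y) (wC x v) (wC u y) (wC x u) (wC v y); ring.
rewrite !L; ring.
Qed.

End SkewForm.

Lemma reduces_std k w w' : skew_form w -> reduces k w w' ->
  exists e : nat -> V, forall i j, (i < k * 2)%N -> (j < k * 2)%N -> w (e i) (e j) = std i j.
Proof.
move=> + r; elim: r => {k w w'} [w w' _|k u v w w' uv _ IHk] sw; first by exists (fun=> 0).
have wC := sw.1; have [e E] := IHk (skew_form_split sw u v).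
(* The projection onto the [w]-orthogonal complement of [u] and [v]; it carries a symplectic system
   of the remainder to one of [w]. *)
pose P x := cst (w x u) *: v + (cst (- w x v) *: u + x).
have PE x y : w (P x) y = split_pair u v w x y.
  rewrite skew_form_comb // /split_pair; ring.
have Pu x : w (P x) u = 0.
  rewrite PE /split_pair (skew_form_diag sw) (wC v u) uv; ring.
have Pv x : w (P x) v = 0.
  rewrite PE /split_pair (skew_form_diag sw) uv; ring.
have PP x y : w (P x) (P y) = split_pair u v w x y.
  rewrite wC PE /split_pair (wC v) (wC u) Pu Pv (wC y) PE /split_pair; ring.
pose e' i := match i with 0%N => u | 1%N => v | i'.+2 => P (e i') end.
exists e' => -[|[|i]] [|[|j]] li lj //=.
- by rewrite (skew_form_diag sw) /std /= subrr.
- by rewrite uv /std /= subr0.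
- by rewrite wC Pu oppr0.
- by rewrite wC uv /std /= sub0r.
- by rewrite (skew_form_diag sw) /std /= subrr.
- by rewrite wC Pv oppr0.
by rewrite PP stdSS E.
Qed.

(** Each plane contributes the wedge of the functionals w(-, u) and w(-, v), so 2k functionals
    suffice to write [w]. *)
Lemma reduces_rank k w w' : skew_form w -> reduces k w w' -> (forall x y, w' x y = 0) ->
  exists2 s : seq ((V -> K) * (V -> K)), size s = k &
    forall x y, w x y = \sum_(ab <- s) (ab.1 x * ab.2 y - ab.2 x * ab.1 y).
Proof.
move=> + r; elim: r => {k w w'} [w w' ww'|k u v w w' uv _ IHk] sw w0.
  by exists [::] => // x y; rewrite big_nil ww' w0.
have [s <- sE] := IHk (skew_form_split sw u v) w0.
exists ((w^~ u, w^~ v) :: s) => // x y; rewrite big_cons -sE /split_pair /= !(sw.1 _ y).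
ring.
Qed.

(** For [w], [I] is skew and [J] self-adjoint. Hence w(x, I y) is symmetric, while w(x, J y) and
    w(x, I (J y)) are skew. The identities are imposed only after pairing with [w], because phi^2
    differs from -1 along the Reeb field. *)
Definition quaternionic w (I J : V -> V) : Prop :=
  [/\ forall x y, w (I x) y = - w x (I y), forall x y, w x (I (I y)) = - w x y,
      forall x y, w (J x) y = w x (J y), forall x y, w x (J (J y)) = - w x y
    & forall x y, w x (I (J y)) = - w x (J (I y))].

(** * Splitting off a quaternionic line *)

Section Quaternionic.
Variables (w : V -> V -> K) (I J : V -> V).
Hypotheses (sw : skew_form w) (qw : quaternionic w I J).

Let wC x y : w x y = - w y x. Proof. by case: sw. Qed.
Let wI x y : w (I x) y = - w x (I y). Proof. by case: qw. Qed.
Let wII x y : w x (I (I y)) = - w x y. Proof. by case: qw. Qed.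
Let wJ x y : w (J x) y = w x (J y). Proof. by case: qw. Qed.
Let wJJ x y : w x (J (J y)) = - w x y. Proof. by case: qw. Qed.
Let wIJ x y : w x (I (J y)) = - w x (J (I y)). Proof. by case: qw. Qed.

Variable x : V.
Let d := w x (I x).
Hypothesis d0 : d != 0.

Let x1 : w x (J x) = 0.
Proof. by apply/eqP; have /eqP := wC x (J x); rewrite wJ -addr_eq0 -mulr2n mulrn_eq0. Qed.

Let x2 : w x (J (I x)) = 0.
Proof.
apply/eqP; have /eqP := wC x (J (I x)); rewrite wJ wI wIJ opprK.
by rewrite -addr_eq0 -mulr2n mulrn_eq0.
Qed.

Let wJIJ y z : w y (J (I (J z))) = w y (I z).
Proof. by apply: oppr_inj; rewrite -wIJ -[LHS]opprK -!wI wJJ opprK. Qed.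

(* The part of w orthogonal to x, I x, J x and I (J x). *)
Definition split_line y z := w y z - d^-1 *
  (w y (I x) * w x z - w y x * w (I x) z + w y (I (J x)) * w (J x) z - w y (J x) * w (I (J x)) z).

(** The pairs x, I x and J x, I (J x) are [w]-orthogonal and [w] takes the value [d] on both, so
    after division by [d] passing to [split_line] amounts to two successive [split_pair]. *)
Lemma reduces_line k w' : reduces k split_line w' -> reduces k.+2 w w'.
Proof.
pose v1 := cst d^-1 *: I x; pose v2 := cst d^-1 *: I (J x).
have uv1 : w x v1 = 1 by rewrite skew_formZr // mulVf.
have c1 : w x v2 = 0 by rewrite skew_formZr // wIJ x2 oppr0 mulr0.
have c2 : w (J x) x = 0 by rewrite wJ x1.
have c3 : w (J x) v1 = 0 by rewrite skew_formZr // wJ x2 mulr0.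
have c4 : w v1 v2 = 0 by rewrite skew_formZ // skew_formZr // wI wII x1 oppr0 oppr0 !mulr0.
have uv2 : split_pair x v1 w (J x) v2 = 1.
  by rewrite /split_pair c1 c2 mulr0 mul0r !subr0 skew_formZr // wJ wJIJ mulVf.
move=> r; apply: (@reducesS _ x v1 w w' uv1); apply: reduces_trans_split uv2 _ r => y z.
have c5 : w v1 (J x) = 0 by rewrite wC c3 oppr0.
have c6 : w v2 v1 = 0 by rewrite wC c4 oppr0.
have c7 : w v2 x = 0 by rewrite wC c1 oppr0.
rewrite /split_pair c1 c2 c3 c4 c5 c6 c7 x1 !mulr0 !mul0r !subr0 /v1 /v2.
rewrite !skew_formZ // !skew_formZr //.
rewrite /split_line; ring.
Qed.

Lemma split_line_skew : skew_form split_line.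
Proof.
have [_ L] := sw; rewrite /split_line; split=> [y z|f y z t]; last by rewrite !L; ring.
rewrite (wC z y) !(wC z) !(wC _ y); ring.
Qed.

Let Iw y z : w y (I z) = - w (I y) z. Proof. by rewrite wI opprK. Qed.
Let IIw y z : w (I (I y)) z = - w y z. Proof. by rewrite !wI wII opprK. Qed.
Let JJw y z : w (J (J y)) z = - w y z. Proof. by rewrite !wJ wJJ. Qed.
Let JIw y z : w (J (I y)) z = - w (I (J y)) z.
Proof. by rewrite wC -wIJ wC. Qed.
Let JIJw y z : w (J (I (J y))) z = w (I y) z.
Proof. by rewrite wC wJIJ -wC. Qed.

(** As seen by [w], the span of x, I x, J x, I (J x) is stable under [I] and [J], hence so is its
    orthogonal complement. *)
Lemma split_line_quaternionic : quaternionic split_line I J.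
Proof.
split=> y z; rewrite /split_line.
- rewrite !(wI y) !wII !(Iw _ z) !IIw; ring.
- by rewrite !wII; ring.
- rewrite !(wJ y) !(wJJ y) !(wJIJ y) -!(wJ _ z) JIw JJw JIJw !(wIJ y); ring.
- by rewrite !wJJ; ring.
- by rewrite !wIJ; ring.
Qed.

End Quaternionic.

(* The symmetric form w x (I y) is polarized. *)
Lemma quaternionic_eq0 w I J : skew_form w -> quaternionic w I J ->
  (forall x, w x (I x) = 0) -> forall x y, w x y = 0.
Proof.
move=> sw [wI wII _ _ _] w0; have wC := sw.1.
have IC x y : w x (I y) = w y (I x) by rewrite -[LHS]opprK -wI wC opprK.
have ID x y z : w (cst 1 *: x + y) (I z) = w x (I z) + w y (I z) by rewrite sw.2 cstK mul1r.
have wI0 x y : w x (I y) = 0.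
  have := w0 (cst 1 *: x + y); rewrite ID !(IC _ (cst 1 *: x + y)) !ID !w0 (IC y x).
  by rewrite add0r addr0 => /eqP; rewrite -mulr2n mulrn_eq0 => /eqP.
by move=> x y; rewrite -[RHS]oppr0 -(wI0 x (I y)) wII opprK.
Qed.

(** Quaternionic lines, worth two planes each, are split off at most [n] times, as long as some w(x,
    I x) is nonzero. If this stops early, [quaternionic_eq0] shows that nothing remains. *)
Lemma reduces_quaternionic n w I J : skew_form w -> quaternionic w I J ->
  (exists w', reduces n.*2 w w') \/
  (exists n' w', [/\ (n' < n)%N, reduces n'.*2 w w' & forall x y, w' x y = 0]).
Proof.
elim: n w => [|n IHn] w sw qw.
  by left; exists w; apply: reduces0.
have [[x x0]|w0] := pselect (exists x, w x (I x) != 0).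
  have [[w' r]|[n' [w' [n'n r w'0]]]] :=
      IHn _ (split_line_skew I J sw x) (split_line_quaternionic sw qw x).
    by left; exists w'; apply: reduces_line x0 _ _ r.
  by right; exists n'.+1, w'; split=> //; apply: reduces_line x0 _ _ r.
right; exists 0%N, w; split=> //; first exact: reduces0.
apply: quaternionic_eq0 sw qw _ => x; apply/eqP/negPn/negP => x0; apply: w0; by exists x.
Qed.

End SkewForms.

(** * The module of vector fields *)

Section VectorFields.
Context {R : realType} {m : nat} {M : smoothManifold R m}.
Implicit Types (X Y Z : vfield M) (f h : Csmooth M) (p : M).

Lemma vfieldP X Y : (forall p f, X p f = Y p f) -> X = Y.
Proof.
case: X Y => [X sX] [Y sY] /= XY.
have E : X = Y by apply: functional_extensionality_dep => p; apply/val_inj/funext => f; exact: XY.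
by rewrite E in sX *; congr VField; exact: Prop_irrelevance.
Qed.

Lemma CsmoothP f h : (forall p, f p = h p) -> f = h.
Proof. by move=> E; apply/val_inj/funext. Qed.

Fact vfield_zero_smooth f : smooth (fun p : M => (0 : tangent p) f).
Proof. exact: (@smooth_cst R m M 0). Qed.
Definition vfield_zero : vfield M := @VField R m M (fun p => 0) vfield_zero_smooth.

Fact vfield_opp_smooth X f : smooth (fun p => (- X p) f).
Proof. by have := Csmooth_smooth (- vact X f). Qed.
Definition vfield_opp X : vfield M := @VField R m M (fun p => - X p) (vfield_opp_smooth X).

Fact vfield_add_smooth X Y f : smooth (fun p => (X p + Y p) f).
Proof. exact: (Csmooth_smooth (vact X f + vact Y f)). Qed.
Definition vfield_add X Y : vfield M :=
  @VField R m M (fun p => X p + Y p) (vfield_add_smooth X Y).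

Fact vfield_scale_smooth h X f : smooth (fun p => (h p *: X p) f).
Proof. exact: (Csmooth_smooth (h * vact X f)). Qed.
Definition vfield_scale h X : vfield M :=
  @VField R m M (fun p => h p *: X p) (vfield_scale_smooth h X).

HB.instance Definition _ := gen_eqMixin (vfield M).
HB.instance Definition _ := gen_choiceMixin (vfield M).

Fact vfield_addA : associative vfield_add.
Proof. by move=> X Y Z; apply: vfieldP => p f; exact: addrA. Qed.
Fact vfield_addC : commutative vfield_add.
Proof. by move=> X Y; apply: vfieldP => p f; exact: addrC. Qed.
Fact vfield_add0 : left_id vfield_zero vfield_add.
Proof. by move=> X; apply: vfieldP => p f; exact: add0r. Qed.
Fact vfield_addN : left_inverse vfield_zero vfield_opp vfield_add.
Proof. by move=> X; apply: vfieldP => p f; exact: addNr. Qed.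
HB.instance Definition _ := GRing.isZmodule.Build (vfield M)
  vfield_addA vfield_addC vfield_add0 vfield_addN.

Fact vfield_scaleA f h X : vfield_scale f (vfield_scale h X) = vfield_scale (f * h) X.
Proof.
apply: vfieldP => p k.
exact: (congr1 (fun t : tangent p => t k) (scalerA (f p) (h p) (X p))).
Qed.
Fact vfield_scale1 : left_id 1 vfield_scale.
Proof.
move=> X; apply: vfieldP => p k.
exact: (congr1 (fun t : tangent p => t k) (scale1r (X p))).
Qed.
Fact vfield_scaleDr : right_distributive vfield_scale +%R.
Proof.
move=> f X Y; apply: vfieldP => p k.
exact: (congr1 (fun t : tangent p => t k) (scalerDr (f p) (X p) (Y p))).
Qed.
Fact vfield_scaleDl X : {morph vfield_scale^~ X : f h / f + h}.
Proof.
move=> f h; apply: vfieldP => p k.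
exact: (congr1 (fun t : tangent p => t k) (scalerDl (X p) (f p) (h p))).
Qed.
HB.instance Definition _ := GRing.Zmodule_isLmodule.Build (Csmooth M) (vfield M)
  vfield_scaleA vfield_scale1 vfield_scaleDr vfield_scaleDl.

Lemma vactD X f h : vact X (f + h) = vact X f + vact X h.
Proof. by apply: CsmoothP => p; have [E _ _] := tangent_derivation (X p); exact: E. Qed.

Lemma vactM X f h : vact X (f * h) = vact X f * h + f * vact X h.
Proof. by apply: CsmoothP => p; have [_ _ E] := tangent_derivation (X p); exact: E. Qed.

Lemma vact0 X : vact X 0 = 0.
Proof. by apply: (addrI (vact X 0)); rewrite -vactD !addr0. Qed.

Lemma vact1 X : vact X 1 = 0.
Proof. by apply: (addrI (vact X 1)); rewrite addr0 -[in RHS](mul1r 1) vactM mul1r mulr1. Qed.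

Lemma vactN X f : vact X (- f) = - vact X f.
Proof. by apply/eqP; rewrite -addr_eq0 -vactD addNr vact0. Qed.

Lemma vactB X f h : vact X (f - h) = vact X f - vact X h.
Proof. by rewrite vactD vactN. Qed.

Lemma vact_lie X Y f : vact (lie X Y) f = vact X (vact Y f) - vact Y (vact X f).
Proof. exact: CsmoothP. Qed.

Lemma lieC X Y : lie X Y = - lie Y X.
Proof. by apply: vfieldP => p f /=; rewrite /GRing.opp /= opprB. Qed.

Lemma lieD X Y Z : lie X (Y + Z) = lie X Y + lie X Z.
Proof.
apply: vfieldP => p f; have [E _ _] := tangent_derivation (X p).
have -> : (lie X (Y + Z)) p f = X p (vact Y f + vact Z f) - (Y p (vact X f) + Z p (vact X f)).
  by rewrite /=; congr (_ - _); congr (X p _); exact: CsmoothP.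
by rewrite E opprD addrACA.
Qed.

Lemma lieZ X f Y : lie X (f *: Y) = vact X f *: Y + f *: lie X Y.
Proof.
apply: vfieldP => p h.
have -> : lie X (f *: Y) p h = vact X (f * vact Y h) p - f p * Y p (vact X h).
  by rewrite /=; congr (_ - _); congr (X p _); exact: CsmoothP.
rewrite vactM.
have -> : (vact X f *: Y + f *: lie X Y) p h =
  vact X f p * Y p h + f p * (X p (vact Y h) - Y p (vact X h)) by [].
by rewrite mulrBr addrA.
Qed.

Lemma lie0 X : lie X 0 = 0.
Proof. by apply: (addrI (lie X 0)); rewrite -lieD !addr0. Qed.

Lemma lieN X Y : lie X (- Y) = - lie X Y.
Proof. by apply/eqP; rewrite -addr_eq0 -lieD addNr lie0. Qed.

Lemma liexx X : lie X X = 0.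
Proof. by apply: vfieldP => p f /=; rewrite subrr. Qed.

Lemma lie_jacobi X Y Z : lie X (lie Y Z) = lie (lie X Y) Z + lie Y (lie X Z).
Proof.
apply: vfieldP => p f.
suff E : vact (lie X (lie Y Z)) f = vact (lie (lie X Y) Z) f + vact (lie Y (lie X Z)) f.
  exact: (congr1 (fun k : Csmooth M => k p) E).
rewrite !vact_lie !vactB; ring.
Qed.

Variables (g : riem_metric M) (eta : one_form M) (phi : endo_field M).

Definition inner X Y : Csmooth M := mkCsmooth (riem_smooth g X Y).
Local Notation "<< X , Y >>" := (inner X Y).

Lemma innerC X Y : <<X, Y>> = <<Y, X>>.
Proof. by apply: CsmoothP => p; exact: riem_sym. Qed.

Lemma inner_linear X f Y Z : <<X, f *: Y + Z>> = f * <<X, Y>> + <<X, Z>>.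
Proof. by apply: CsmoothP => p; exact: riem_linear. Qed.

Lemma innerD X Y Z : <<X, Y + Z>> = <<X, Y>> + <<X, Z>>.
Proof. by rewrite -[Y]scale1r inner_linear mul1r scale1r. Qed.

Lemma inner0 X : <<X, 0>> = 0.
Proof. by apply: (addrI <<X, 0>>); rewrite -innerD !addr0. Qed.

Lemma innerZ X f Y : <<X, f *: Y>> = f * <<X, Y>>.
Proof. by rewrite -[f *: Y]addr0 inner_linear inner0 addr0. Qed.

Lemma innerN X Y : <<X, - Y>> = - <<X, Y>>.
Proof. by rewrite -scaleN1r innerZ mulN1r. Qed.

Lemma innerDl X Y Z : <<X + Y, Z>> = <<X, Z>> + <<Y, Z>>.
Proof. by rewrite innerC innerD !(innerC Z). Qed.

Lemma innerZl f X Y : <<f *: X, Y>> = f * <<X, Y>>.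
Proof. by rewrite innerC innerZ innerC. Qed.

Lemma innerNl X Y : <<- X, Y>> = - <<X, Y>>.
Proof. by rewrite innerC innerN innerC. Qed.

Lemma inner_eq0 X : <<X, X>> = 0 -> X = 0.
Proof.
move=> X0; apply: vfieldP => p f; suff -> : X p = 0 by [].
apply/eqP; apply: contraT => /(riem_pos g); have := congr1 (fun k : Csmooth M => k p) X0.
by move=> /= ->; rewrite ltxx.
Qed.

Lemma inner_inj X Y : (forall Z, <<Z, X>> = <<Z, Y>>) -> X = Y.
Proof.
move=> E; apply/eqP; rewrite -subr_eq0; apply/eqP/inner_eq0.
by rewrite innerD innerN E subrr.
Qed.

Lemma eval1D X Y : eval1 eta (X + Y) = eval1 eta X + eval1 eta Y.
Proof. by apply: CsmoothP => p; exact: (linearD (eta p)). Qed.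

Lemma eval1Z f X : eval1 eta (f *: X) = f * eval1 eta X.
Proof. by apply: CsmoothP => p; exact: (scalarZ (eta p)). Qed.

Lemma eval1N X : eval1 eta (- X) = - eval1 eta X.
Proof. by rewrite -scaleN1r eval1Z mulN1r. Qed.

Lemma eval10 : eval1 eta 0 = 0.
Proof. by apply: (addrI (eval1 eta 0)); rewrite -eval1D !addr0. Qed.

Lemma endoD X Y : endo_app phi (X + Y) = endo_app phi X + endo_app phi Y.
Proof. by apply: vfieldP => p f; congr (tangent_fun _ f); exact: (linearD (phi p)). Qed.

Lemma endoZ f X : endo_app phi (f *: X) = f *: endo_app phi X.
Proof. by apply: vfieldP => p k; congr (tangent_fun _ k); exact: (linearZ_LR (phi p)). Qed.

Lemma endoN X : endo_app phi (- X) = - endo_app phi X.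
Proof. by rewrite -scaleN1r endoZ scaleN1r. Qed.

Lemma endo0 : endo_app phi 0 = 0.
Proof. by apply: (addrI (endo_app phi 0)); rewrite -endoD !addr0. Qed.

End VectorFields.

(** * Quasi-Sasakian structures *)

Section ExteriorDerivative.
Context {R : realType} {m : nat} {M : smoothManifold R m}.
Implicit Types (X Y Z : vfield M) (f h : Csmooth M) (eta : one_form M).

(** Twice the exterior derivative. An arbitrary map [w] is allowed so that the formula also covers
    eta_a composed with phi_b. *)
Definition dform (w : vfield M -> Csmooth M) X Y : Csmooth M :=
  vact X (w Y) - vact Y (w X) - w (lie X Y).

Lemma d1E eta X Y p : d1 eta X Y p = 2^-1 * dform (eval1 eta) X Y p.
Proof. by []. Qed.

Lemma dformC eta X Y : dform (eval1 eta) X Y = - dform (eval1 eta) Y X.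
Proof. rewrite /dform (lieC X Y) eval1N; ring. Qed.

(** L_Z commutes with d, by the Jacobi identity, so L_Z eta = 0 implies L_Z (d eta) = 0. *)
Lemma dform_invariant eta Z : (forall X, vact Z (eval1 eta X) = eval1 eta (lie Z X)) ->
  forall X Y, vact Z (dform (eval1 eta) X Y) =
    dform (eval1 eta) (lie Z X) Y + dform (eval1 eta) X (lie Z Y).
Proof.
move=> inv X Y; rewrite /dform !vactB inv lie_jacobi eval1D !vact_lie -!inv; ring.
Qed.

End ExteriorDerivative.

Section QuasiSasakian.
Context {R : realType} {m : nat} {M : smoothManifold R m}.
Variables (phi : endo_field M) (xi : vfield M) (eta : one_form M) (g : riem_metric M).
Implicit Types (X Y Z : vfield M).
Local Notation "<< X , Y >>" := (inner g X Y).
Local Notation F := (endo_app phi).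
Local Notation H := (eval1 eta).

Section AlmostContactMetric.
Hypothesis acm : almost_contact_metric phi xi eta g.

Lemma acm_sqr X : F (F X) = - X + H X *: xi.
Proof.
have [E _ _] := acm.
by apply: vfieldP => p f; exact: (congr1 (fun t : tangent p => t f) (E p (X p))).
Qed.

Lemma eval1_reeb : H xi = 1.
Proof. by have [_ E _] := acm; apply: CsmoothP => p; exact: E. Qed.

Lemma acm_inner X Y : <<F X, F Y>> = <<X, Y>> - H X * H Y.
Proof. by have [_ _ E] := acm; apply: CsmoothP => p; exact: E. Qed.

(** Evaluating phi^3 xi gives phi xi = a xi, then phi^2 xi = 0 gives a^2 = 0, and definiteness of g
    concludes. *)
Lemma endo_reeb : F xi = 0.
Proof.
have F2 : F (F xi) = 0 by rewrite acm_sqr eval1_reeb scale1r addNr.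
have Fxi : F xi = H (F xi) *: xi.
  apply/eqP; rewrite -subr_eq0 -opprB oppr_eq0 addrC -acm_sqr.
  by rewrite F2 endo0.
have : H (F xi) * H (F xi) = 0.
  move: (congr1 H F2); rewrite {1}Fxi endoZ eval1Z => ->.
  exact: eval10.
move=> a0; apply: (@inner_eq0 _ _ _ g); move: a0 Fxi; set a := H (F xi) => a0 ->.
by rewrite innerZ innerZl mulrA a0 mul0r.
Qed.

Lemma eval1_endo X : H (F X) = 0.
Proof.
have : F (F (F X)) = - F X by rewrite (acm_sqr X) endoD endoN endoZ endo_reeb scaler0 addr0.
rewrite acm_sqr => /(congr1 H); rewrite eval1D eval1Z eval1_reeb mulr1 eval1N.
by rewrite addNr => /esym/eqP; rewrite oppr_eq0 => /eqP.
Qed.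

Lemma inner_reeb X : <<X, xi>> = H X.
Proof.
have := acm_inner X xi; rewrite endo_reeb inner0 eval1_reeb mulr1.
by move/esym/eqP; rewrite subr_eq0 => /eqP.
Qed.

Lemma inner_endo X Y : <<F X, Y>> = - <<X, F Y>>.
Proof.
have := acm_inner X (F Y); rewrite eval1_endo mulr0 subr0 acm_sqr => <-.
by rewrite innerD innerN innerZ inner_reeb eval1_endo mulr0 addr0 opprK.
Qed.

End AlmostContactMetric.

Hypothesis qs : quasi_sasakian phi xi eta g.

Let acm : almost_contact_metric phi xi eta g.
Proof. by case: qs. Qed.

Lemma qs_normal X Y : F (F (lie X Y)) + lie (F X) (F Y) - F (lie (F X) Y) - F (lie X (F Y))
  + dform H X Y *: xi = 0.
Proof.
have [_ N _] := qs; apply: vfieldP => p f.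
have := congr1 (fun t : tangent p => t f) (N X Y p).
by rewrite d1E mulrA divff ?mul1r // pnatr_eq0.
Qed.

(** As phi xi = 0 and eta vanishes on the image of phi, eta applied to normality with Y = xi retains
    only this term. *)
Lemma dform_reeb X : dform H X xi = 0.
Proof.
have := congr1 H (qs_normal X xi).
rewrite endo_reeb // !lie0 endo0 oppr0 !addr0 !eval1D eval1N eval1Z !eval1_endo //.
rewrite eval1_reeb // oppr0 !add0r mulr1 => ->.
exact: eval10.
Qed.

Lemma vact_reeb_eval1 X : vact xi (H X) = H (lie xi X).
Proof.
have := dform_reeb X; rewrite /dform eval1_reeb // vact1 sub0r lieC eval1N opprK.
by rewrite addrC => /eqP; rewrite subr_eq0 => /eqP ->.
Qed.

(** Normality with Y = xi says that phi kills (L_xi phi) X. So does eta, and phi^2 = -1 on the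
    kernel of eta. *)
Lemma lie_reeb_endo X : lie xi (F X) = F (lie xi X).
Proof.
have h : H (lie xi (F X)) = 0 by rewrite -vact_reeb_eval1 eval1_endo // vact0.
have := qs_normal X xi; rewrite dform_reeb scale0r addr0 endo_reeb // !lie0 endo0 oppr0 !addr0.
rewrite (lieC (F X)) (lieC X) !endoN opprK -endoN -endoD => /(congr1 F).
rewrite endo0 acm_sqr // eval1D eval1N eval1_endo // h oppr0 addr0 scale0r addr0 => /eqP.
by rewrite oppr_eq0 addrC subr_eq0 => /eqP.
Qed.

Lemma fund_form_closed X Y Z :
  vact X <<Y, F Z>> + vact Y <<Z, F X>> + vact Z <<X, F Y>>
  - <<lie X Y, F Z>> - <<lie Y Z, F X>> - <<lie Z X, F Y>> = 0.
Proof.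
have [_ _ E] := qs; apply: CsmoothP => p.
have /eqP := E X Y Z p; rewrite mulf_eq0 invr_eq0 pnatr_eq0 /= => /eqP E'.
exact: E'.
Qed.

(** Closedness of the fundamental form along xi, with L_xi phi = 0, gives the invariance of g(U, phi
    W). Every Y is - phi (phi Y) + eta(Y) xi, and L_xi eta = 0 settles the last component. *)
Lemma killing X Y : vact xi <<X, Y>> = <<lie xi X, Y>> + <<X, lie xi Y>>.
Proof.
have KF U W : vact xi <<U, F W>> = <<lie xi U, F W>> + <<U, lie xi (F W)>>.
  have := fund_form_closed xi U W.
  rewrite endo_reeb // inner0 !(innerC g xi) !(inner_reeb acm) !eval1_endo //.
  rewrite !vact0 inner0 (lieC W) innerNl (innerC g _ (F U)) inner_endo // -lie_reeb_endo.
  by move=> E; apply/eqP; rewrite -subr_eq0 -{}E; apply/eqP; ring.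
have -> : Y = - F (F Y) + H Y *: xi by rewrite acm_sqr // opprD opprK subrK.
rewrite lieD lieN lieZ liexx scaler0 addr0 !innerD !innerN !innerZ vactD vactN vactM KF.
rewrite !inner_reeb //.
rewrite !vact_reeb_eval1; ring.
Qed.

End QuasiSasakian.

(** * 3-quasi-Sasakian structures *)

Definition cyc (a b c : 'I_3) : bool :=
  (a, b, c) \in [:: (0, 1, 2); (1, 2, 0); (2, 0, 1) : 'I_3 * 'I_3 * 'I_3].

Lemma cyc_rot a b c : cyc a b c -> cyc b c a.
Proof. by rewrite /cyc !inE => /or3P[] /eqP[-> -> ->]. Qed.

Lemma cyc_ex c : exists a b, cyc a b c.
Proof. by exists (c + 1), (c + 2); case: c => -[|[|[|]]]. Qed.

(** In Z/3 the three indices add up to 0, so the third one is - (a + b). *)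
Lemma cyc_pair a b : [|| a == b, cyc a b (- (a + b)) | cyc b a (- (a + b))].
Proof. by case: a b => -[|[|[|]]] // ? [[|[|[|]]]]. Qed.

Lemma cyc_even a b c : cyc a b c ->
  exists2 s : 'S_3, ~~ odd_perm s & [/\ a = s 0, b = s 1 & c = s 2].
Proof.
have rot s : ~~ odd_perm s ->
    exists2 t : 'S_3, ~~ odd_perm t & [/\ s 1 = t 0, s 2 = t 1 & s 0 = t 2].
  move=> s_even; exists (tperm (0%R : 'I_3) 1%R * tperm (0%R : 'I_3) 2%R * s)%g.
    by rewrite !odd_permM !odd_tperm (negbTE s_even).
  split; rewrite !permM; [by rewrite tpermL tpermD|by rewrite tpermR tpermL|].
  by rewrite (@tpermD _ _ _ 2) ?tpermR.
have s1 : ~~ odd_perm (1%g : 'S_3) by rewrite odd_perm1.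
have [s2 e2 [p q r]] := rot _ s1; have [s3 e3 [p' q' r']] := rot _ e2.
rewrite !perm1 in p q r; rewrite /cyc !inE => /or3P[] /eqP[-> -> ->].
- by exists 1%g => //; rewrite !perm1.
- by exists s2.
by exists s3 => //; rewrite -p' -q' -r'.
Qed.

Section ThreeQuasiSasakian.
Context {R : realType} {n : nat} {M : smoothManifold R (4 * n + 3)}.
Variables (phi : 'I_3 -> endo_field M) (xi : 'I_3 -> vfield M)
  (eta : 'I_3 -> one_form M) (g : riem_metric M).
Implicit Types (X Y Z : vfield M).
Local Notation "<< X , Y >>" := (inner g X Y).
Local Notation F a := (endo_app (phi a)).
Local Notation H a := (eval1 (eta a)).

Hypothesis tqs : three_quasi_sasakian phi xi eta g.

Let qs a : quasi_sasakian (phi a) (xi a) (eta a) g.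
Proof. by have [_] := tqs. Qed.

Let acm a : almost_contact_metric (phi a) (xi a) (eta a) g.
Proof. by case: (qs a). Qed.

Section CyclicTriple.
Variables (a b c : 'I_3).
Hypothesis abc : cyc a b c.

Lemma cyc_endo X : F c X = F a (F b X) - H b X *: xi a.
Proof.
have [s s_even [-> -> ->]] := cyc_even abc; apply: vfieldP => p f.
by have [/(_ (X p))[E _] _ _] := tqs.1.2 s s_even p; exact: (congr1 (fun t : tangent p => t f) E).
Qed.

Lemma cyc_endo' X : F c X = - F b (F a X) + H a X *: xi b.
Proof.
have [s s_even [-> -> ->]] := cyc_even abc; apply: vfieldP => p f.
by have [/(_ (X p))[_ E] _ _] := tqs.1.2 s s_even p; exact: (congr1 (fun t : tangent p => t f) E).
Qed.

Lemma cyc_reeb : F a (xi b) = xi c.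
Proof.
have [s s_even [-> -> ->]] := cyc_even abc; apply: vfieldP => p f.
by have [_ [E _] _] := tqs.1.2 s s_even p; rewrite E.
Qed.

Lemma cyc_reeb' : F b (xi a) = - xi c.
Proof.
have [s s_even [-> -> ->]] := cyc_even abc; apply: vfieldP => p f.
have [_ [_ E] _] := tqs.1.2 s s_even p.
have -> : (- xi (s 2)) p = - (xi (s 2) p) by [].
by rewrite E opprK.
Qed.

Lemma cyc_eta X : H a (F b X) = H c X.
Proof.
have [s s_even [-> -> ->]] := cyc_even abc; apply: CsmoothP => p.
by have [_ _ /(_ (X p))[E _]] := tqs.1.2 s s_even p; rewrite /= E.
Qed.

Lemma cyc_eta' X : H b (F a X) = - H c X.
Proof.
have [s s_even [-> -> ->]] := cyc_even abc; apply: CsmoothP => p.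
have [_ _ /(_ (X p))[_ E]] := tqs.1.2 s s_even p.
have -> : (- H (s 2) X) p = - eta (s 2) p (X p) by [].
by rewrite E opprK.
Qed.

Lemma cyc_eta_reeb : H a (xi c) = 0.
Proof. by rewrite -cyc_reeb (eval1_endo (acm a)). Qed.

Lemma cyc_eta_reeb' : H b (xi c) = 0.
Proof. by rewrite -[xi c]opprK -cyc_reeb' eval1N (eval1_endo (acm b)) oppr0. Qed.

End CyclicTriple.

(* The Lie derivative of phi b along xi a. *)
Definition lie_endo a b X := lie (xi a) (F b X) - F b (lie (xi a) X).
Local Notation S := lie_endo.

Lemma lie_endoE a b X : S a b X = lie (xi a) (F b X) - F b (lie (xi a) X).
Proof. by []. Qed.

Lemma lie_endoD a b X Y : S a b (X + Y) = S a b X + S a b Y.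
Proof. by rewrite /S !endoD !lieD endoD opprD addrACA. Qed.

Lemma lie_endoZ a b f X : S a b (f *: X) = f *: S a b X.
Proof. by rewrite /S endoZ !lieZ endoD !endoZ opprD addrACA subrr add0r scalerBr. Qed.

Lemma lie_endoN a b X : S a b (- X) = - S a b X.
Proof. by rewrite -scaleN1r lie_endoZ scaleN1r. Qed.

(* Cartan's formula, using that xi a is Killing and that the fundamental form
   of phi b is closed. *)
Lemma inner_lie_endo a b X Y : <<X, S a b Y>> = dform (fun Z => H a (F b Z)) X Y.
Proof.
have := fund_form_closed (qs b) (xi a) X Y; have := killing (qs a) X (F b Y).
have IE U W : <<U, F b W>> = - <<F b U, W>> by rewrite (inner_endo (acm b)) opprK.
rewrite /dform /S innerD innerN (IE Y) (IE (lie X Y)) !(inner_reeb (acm a)) => ->.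
rewrite (innerC g (xi a)) (inner_reeb (acm a)) (lieC Y) innerNl (IE (lie (xi a) Y)).
rewrite (innerC g (F b (lie _ Y))) vactN => E; apply/eqP; rewrite -subr_eq0 -{}E; apply/eqP.
ring.
Qed.

Section LieDerivative.
Variables (a b c : 'I_3).
Hypothesis abc : cyc a b c.

Lemma inner_lie_endo_dform X Y : <<X, S a b Y>> = dform (H c) X Y.
Proof. by rewrite inner_lie_endo /dform !(cyc_eta abc). Qed.

(** Since eta_a phi_b = eta_c and eta_b phi_a = - eta_c, Cartan's formula expresses both sides
    through d eta_c. *)
Lemma lie_endoC X : S b a X = - S a b X.
Proof.
apply: (@inner_inj _ _ _ g) => Z.
rewrite innerN inner_lie_endo_dform inner_lie_endo /dform !(cyc_eta' abc) !vactN; ring.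
Qed.

Lemma lie_endo_skew X Y : <<X, S a b Y>> = - <<Y, S a b X>>.
Proof. by rewrite !inner_lie_endo_dform dformC. Qed.

Lemma lie_endo_reeb : S a b (xi c) = 0.
Proof.
by apply: (@inner_inj _ _ _ g) => Z; rewrite inner_lie_endo_dform (dform_reeb (qs c)) inner0.
Qed.

Lemma eta_lie_endo X : H c (S a b X) = 0.
Proof. by rewrite -(inner_reeb (acm c)) innerC lie_endo_skew lie_endo_reeb inner0 oppr0. Qed.

(** The Leibniz rule for phi_a phi_b - eta_b (x) xi_a along xi_b, which leaves phi_b and eta_b
    invariant. *)
Lemma lie_endo_rot X : S b c X = - S a b (F b X) + H b X *: lie (xi a) (xi b).
Proof.
rewrite -lie_endoC /S !(cyc_endo abc) lieD lieN lieZ (vact_reeb_eval1 (qs b)).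
rewrite (lie_reeb_endo (qs b) X) (lieC (xi b) (xi a)) scalerN.
by apply: (@inner_inj _ _ _ g) => Z; rewrite !(innerD, innerN); ring.
Qed.

Lemma lie_endo_reeb1 : S a b (xi a) = lie (xi c) (xi a).
Proof. by rewrite /S (cyc_reeb' abc) liexx endo0 subr0 lieN -lieC. Qed.

Lemma lie_endo_reeb2 : S a b (xi b) = - lie (xi b) (xi c).
Proof. by rewrite -[LHS]opprK -lie_endoC /S (cyc_reeb abc) liexx endo0 subr0. Qed.

Lemma endo_lie_reeb : F b (lie (xi a) (xi b)) = lie (xi b) (xi c).
Proof.
apply: oppr_inj; rewrite -lie_endo_reeb2 /S (endo_reeb (acm b)).
by rewrite lie0 add0r.
Qed.

End LieDerivative.

(** * Brackets of the Reeb fields *)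

Section Vertical.
Variables (a b c : 'I_3).
Hypothesis abc : cyc a b c.
Let bca := cyc_rot abc.
Let cab := cyc_rot bca.

(** Compute eta_c (T_a (phi_a^2 X)) twice: [lie_endo_rot] moves it to eta_c on the image of T_c,
    which is 0, while phi_a^2 X = - X and skewness of T_a give the inner product. *)
Lemma lie_reeb_horizontal X : H a X = 0 -> H b X = 0 -> H c X = 0 ->
  <<X, lie (xi c) (xi a)>> = 0.
Proof.
move=> aX bX cX; have FF : F b (F a (F a X)) = - F c (F a X).
  by rewrite (cyc_endo' abc (F a X)) (eval1_endo (acm a)) scale0r addr0 opprK.
have : H c (S b c (F a (F a X))) = 0.
  rewrite (lie_endo_rot abc) FF lie_endoN opprK (cyc_eta' abc) (cyc_eta cab) bX.
  by rewrite oppr0 scale0r addr0 (eta_lie_endo abc).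
rewrite (acm_sqr (acm a)) aX scale0r addr0 lie_endoN eval1N => /eqP; rewrite oppr_eq0.
rewrite -(inner_reeb (acm c)) innerC (lie_endo_skew bca) (lie_endo_reeb2 bca).
by rewrite innerN opprK => /eqP.
Qed.

(** Invariance of eta_a along xi_a and of eta_c along xi_c removes these two components. The bracket
    minus its xi_b component is then horizontal, hence orthogonal to the bracket and to itself. *)
Lemma lie_reeb_vertical : lie (xi c) (xi a) = H b (lie (xi c) (xi a)) *: xi b.
Proof.
set Z := lie _ _; have aZ : H a Z = 0.
  by rewrite /Z lieC eval1N -(vact_reeb_eval1 (qs a)) (cyc_eta_reeb abc) vact0 oppr0.
have cZ : H c Z = 0.
  by rewrite -(vact_reeb_eval1 (qs c)) (cyc_eta_reeb' bca) vact0.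
apply/eqP; rewrite -subr_eq0; apply/eqP/(@inner_eq0 _ _ _ g).
set W := Z - _.
have bW : H b W = 0 by rewrite eval1D eval1N eval1Z (eval1_reeb (acm b)) mulr1 subrr.
rewrite {2}/W innerD innerN innerZ (inner_reeb (acm b)) bW mulr0 subr0.
apply: lie_reeb_horizontal => //; rewrite eval1D eval1N eval1Z ?aZ ?cZ.
  by rewrite (cyc_eta_reeb' cab) mulr0 subr0.
by rewrite (cyc_eta_reeb cab) mulr0 subr0.
Qed.

Lemma lie_reeb_coef : H c (lie (xi a) (xi b)) = H a (lie (xi b) (xi c)).
Proof.
by rewrite -(endo_lie_reeb abc) (cyc_eta abc).
Qed.

End Vertical.

Lemma lie_reebs a b c : cyc a b c ->
  exists k, [/\ lie (xi a) (xi b) = k *: xi c, lie (xi b) (xi c) = k *: xi a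
               & lie (xi c) (xi a) = k *: xi b].
Proof.
move=> abc; have bca := cyc_rot abc; have cab := cyc_rot bca.
exists (H c (lie (xi a) (xi b))); split.
- exact: lie_reeb_vertical bca.
- by rewrite (lie_reeb_coef abc); exact: lie_reeb_vertical cab.
- by rewrite (lie_reeb_coef abc) (lie_reeb_coef bca); exact: lie_reeb_vertical abc.
Qed.

(** * The case of commuting Reeb fields *)

Section Commuting.
Hypothesis comm : forall a b, lie (xi a) (xi b) = 0.

(** The Killing field xi_z commutes with xi_c, so it preserves eta_c and d eta_c, hence also T_c,
    which g and d eta_c determine. *)
Lemma lie_reeb_lie_endo z a b c X : cyc a b c -> lie (xi z) (S a b X) = S a b (lie (xi z) X).
Proof.
move=> abc; have inv Y : vact (xi z) (H c Y) = H c (lie (xi z) Y).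
  by rewrite -!(inner_reeb (acm c)) (killing (qs z)) comm inner0 addr0.
apply: (@inner_inj _ _ _ g) => Y.
have := killing (qs z) Y (S a b X).
rewrite !(inner_lie_endo_dform abc) (dform_invariant inv).
by move/addrI.
Qed.

Lemma lie_endo_commuting a b c X : cyc a b c -> S a b X = 0.
Proof.
move=> abc; have rot Y : S b c Y = - S a b (F b Y).
  by rewrite (lie_endo_rot abc) comm scaler0 addr0.
(* L_(xi_a) commutes with T_c and with T_a = - T_c phi_b, so T_c kills the commutator of L_(xi_a)
   and phi_b, which is T_c. *)
have : S a b (S a b X) = 0.
  have := lie_reeb_lie_endo a X (cyc_rot abc).
  rewrite !rot lieN (lie_reeb_lie_endo _ _ abc) => /oppr_inj E.
  by rewrite (lie_endoE _ _ X) lie_endoD lie_endoN E subrr.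
move=> SS; apply: (@inner_eq0 _ _ _ g).
by rewrite (lie_endo_skew abc) SS inner0 oppr0.
Qed.

Lemma dform_commuting a b c X Y : cyc a b c -> dform (H c) X Y = 0.
Proof. by move=> abc; rewrite -(inner_lie_endo_dform abc) (lie_endo_commuting _ abc) inner0. Qed.

End Commuting.

(** * Quaternionic relations on the horizontal distribution *)

Section Horizontal.
Variable k : Csmooth M.

(* The correction term makes this lie_endo a b after projection onto the
   orthogonal complement of the Reeb fields. *)
Definition hlie_endo a b X := S a b X + k *: (H b X *: xi a - H a X *: xi b).
Local Notation T := hlie_endo.

Hypothesis lie_k : forall a b c, cyc a b c -> lie (xi a) (xi b) = k *: xi c.

Section HorizontalPart.
Variables (a b c : 'I_3).
Hypothesis abc : cyc a b c.
Let bca := cyc_rot abc.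
Let cab := cyc_rot bca.

Lemma hlie_endo_skew X Y : <<X, T a b Y>> = - <<Y, T a b X>>.
Proof.
rewrite /T; move: (lie_endo_skew abc X Y); move: (S a b X) (S a b Y) => U W E.
rewrite !innerD !innerZ !innerD !innerN !innerZ !(inner_reeb (acm _)) E; ring.
Qed.

Lemma hlie_endoD X Y : T a b (X + Y) = T a b X + T a b Y.
Proof.
apply: (@inner_inj _ _ _ g) => Z.
rewrite /T lie_endoD !eval1D !(innerD, innerN, innerZ); ring.
Qed.

Lemma hlie_endoZ f X : T a b (f *: X) = f *: T a b X.
Proof.
apply: (@inner_inj _ _ _ g) => Z.
rewrite /T lie_endoZ !eval1Z !(innerD, innerN, innerZ); ring.
Qed.

Lemma hlie_endo_reeb i : i \in [:: a; b; c] -> T a b (xi i) = 0.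
Proof.
rewrite !inE => /or3P[] /eqP ->; rewrite /T.
- rewrite (lie_endo_reeb1 abc) (lie_k cab) (eval1_reeb (acm a)) (cyc_eta_reeb bca).
  by rewrite scale0r sub0r scale1r scalerN subrr.
- rewrite (lie_endo_reeb2 abc) (lie_k bca) (eval1_reeb (acm b)) (cyc_eta_reeb' cab).
  by rewrite scale0r subr0 scale1r addNr.
- rewrite (lie_endo_reeb abc) (cyc_eta_reeb abc) (cyc_eta_reeb' abc).
  by rewrite !scale0r subr0 scaler0 addr0.
Qed.

(** The correction terms absorb the bracket [xi_a, xi_b] that appears in [lie_endo_rot]. *)
Lemma hlie_endo_rot X : T b c X = - T a b (F b X).
Proof.
rewrite /T (lie_endo_rot abc) (eval1_endo (acm b)) (cyc_eta abc) (lie_k abc).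
apply: (@inner_inj _ _ _ g) => Z.
rewrite !(innerD, innerN, innerZ); ring.
Qed.

End HorizontalPart.

Section AdjointB.
Variables (a b c : 'I_3).
Hypothesis abc : cyc a b c.
Let bca := cyc_rot abc.

(** By [hlie_endo_rot] the composite of [T a b] with phi_b is skew, as [T a b] itself is. *)
Lemma hlie_endo_formb X Y : <<F b X, T a b Y>> = <<X, T a b (F b Y)>>.
Proof.
apply: oppr_inj; rewrite -(innerN g X) -(hlie_endo_rot abc) (hlie_endo_skew bca).
by rewrite (hlie_endo_rot abc) innerN opprK -(hlie_endo_skew abc).
Qed.

End AdjointB.

Section QuaternionicRelations.
Variables (a b c : 'I_3).
Hypothesis abc : cyc a b c.
Let bca := cyc_rot abc.

(** [T a b] kills the Reeb fields, so under it the phi's multiply like quaternion units; the next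
    four lemmas rest on the same fact. *)
Lemma hlie_endo_formbb X Y : <<X, T a b (F b (F b Y))>> = - <<X, T a b Y>>.
Proof.
rewrite (acm_sqr (acm b)) -scaleN1r hlie_endoD !hlie_endoZ (hlie_endo_reeb abc).
  by rewrite scaler0 addr0 scaleN1r innerN.
by rewrite !inE eqxx orbT.
Qed.

Lemma hlie_endo_formcc X Y : <<X, T a b (F c (F c Y))>> = - <<X, T a b Y>>.
Proof.
rewrite (acm_sqr (acm c)) -scaleN1r hlie_endoD !hlie_endoZ (hlie_endo_reeb abc).
  by rewrite scaler0 addr0 scaleN1r innerN.
by rewrite !inE eqxx !orbT.
Qed.

Lemma hlie_endo_formba X Y : <<X, T a b (F b (F a Y))>> = - <<X, T a b (F c Y)>>.
Proof.
rewrite (cyc_endo' abc) -(scaleN1r (F b _)) hlie_endoD !hlie_endoZ (hlie_endo_reeb abc).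
  by rewrite scaler0 addr0 scaleN1r innerN opprK.
by rewrite !inE eqxx !orbT.
Qed.

Lemma hlie_endo_formcb X Y : <<X, T a b (F c (F b Y))>> = - <<X, T a b (F a Y)>>.
Proof.
rewrite (cyc_endo' bca) -(scaleN1r (F c _)) hlie_endoD !hlie_endoZ (hlie_endo_reeb abc).
  by rewrite scaler0 addr0 scaleN1r innerN opprK.
by rewrite !inE eqxx !orbT.
Qed.

Lemma hlie_endo_formbc X Y : <<X, T a b (F b (F c Y))>> = <<X, T a b (F a Y)>>.
Proof.
rewrite (cyc_endo bca) -scaleNr hlie_endoD hlie_endoZ (hlie_endo_reeb abc).
  by rewrite scaler0 addr0.
by rewrite !inE eqxx !orbT.
Qed.

End QuaternionicRelations.

Section Adjoints.
Variables (a b c : 'I_3).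
Hypothesis abc : cyc a b c.
Let bca := cyc_rot abc.
Let cab := cyc_rot bca.

Lemma hlie_endo_forma X Y : <<F a X, T a b Y>> = <<X, T a b (F a Y)>>.
Proof.
rewrite (hlie_endo_rot cab) innerN (hlie_endo_formb cab) (hlie_endo_formbb cab) opprK.
by rewrite (hlie_endo_rot cab) innerN (hlie_endo_formbb cab) opprK.
Qed.

(** Moving phi_a and phi_b across in turn reverses their order, and reversing the product changes
    the sign of phi_c. *)
Lemma hlie_endo_formc X Y : <<F c X, T a b Y>> = - <<X, T a b (F c Y)>>.
Proof.
have xi0 : <<xi a, T a b Y>> = 0.
  by rewrite (hlie_endo_skew abc) (hlie_endo_reeb abc) ?inE ?eqxx // inner0 oppr0.
rewrite (cyc_endo abc) innerDl innerNl innerZl xi0 mulr0 subr0.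
by rewrite hlie_endo_forma (hlie_endo_formb abc) (hlie_endo_formba abc).
Qed.

End Adjoints.
End Horizontal.
End ThreeQuasiSasakian.

(** * The rank *)

Section Rank.
Context {R : realType} {n : nat} {M : smoothManifold R (4 * n + 3)}.
Variables (phi : 'I_3 -> endo_field M) (xi : 'I_3 -> vfield M)
  (eta : 'I_3 -> one_form M) (g : riem_metric M).
Hypothesis tqs : three_quasi_sasakian phi xi eta g.
Local Notation F a := (endo_app (phi a)).
Local Notation H a := (eval1 (eta a)).
Local Notation "<< X , Y >>" := (inner g X Y).

Let acm a : almost_contact_metric (phi a) (xi a) (eta a) g.
Proof. by have [_ /(_ a)[]] := tqs. Qed.

Let cst_smooth (a : R) : Csmooth M := mkCsmooth (@smooth_cst R _ M a).

Variables (p : M) (a b c : 'I_3) (k : Csmooth M).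
Hypotheses (abc : cyc a b c)
  (lie_k : forall a b c, cyc a b c -> lie (xi a) (xi b) = k *: xi c).
Let ev (f : Csmooth M) : R := f p.
Let cstK : cancel cst_smooth ev. Proof. by []. Qed.
Let w X Y := d1 (eta c) X Y p.

Let wE X Y : w X Y = 2^-1 * << X, lie_endo phi xi a b Y >> p.
Proof. by rewrite /w d1E -(inner_lie_endo_dform tqs abc). Qed.

Lemma d1_skew : skew_form ev w.
Proof.
split=> [X Y|f X Y Z].
  by rewrite !wE (lie_endo_skew tqs abc) mulrN.
rewrite !wE (innerC g (_ + _)) inner_linear !(innerC g (lie_endo _ _ _ _ _)).
rewrite mulrDr; congr (_ + _); exact: mulrCA.
Qed.

Hypothesis kp : k p != 0.

Let T := hlie_endo phi xi eta k a b.

Let wab : w (xi a) (xi b) = - (2^-1 * k p).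
Proof.
rewrite wE (lie_endo_reeb2 tqs abc) (lie_k (cyc_rot abc)) innerN innerZ (inner_reeb (acm a)).
by rewrite (eval1_reeb (acm a)) mulr1 mulrN.
Qed.

Let v := cst_smooth (w (xi a) (xi b))^-1 *: xi b.

Let uv : w (xi a) v = 1.
Proof.
rewrite (skew_formZr cstK d1_skew) mulVf // wab oppr_eq0 mulf_neq0 // invr_eq0 pnatr_eq0.
Qed.

(** The correction term of [hlie_endo] is what is subtracted when the plane of xi_a and xi_b,
    hyperbolic because k(p) is nonzero, is split off. *)
Let split_reeb X Y : split_pair (xi a) v w X Y = 2^-1 * << X, T Y >> p.
Proof.
have wxa Z : w Z (xi a) = 2^-1 * (k p * H b Z p).
  rewrite wE (lie_endo_reeb1 tqs abc) (lie_k (cyc_rot (cyc_rot abc))) innerZ.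
  by rewrite (inner_reeb (acm b)).
have wxb Z : w Z (xi b) = - (2^-1 * (k p * H a Z p)).
  rewrite wE (lie_endo_reeb2 tqs abc) (lie_k (cyc_rot abc)) innerN innerZ.
  by rewrite (inner_reeb (acm a)) mulrN.
have wC := d1_skew.1.
have TE : << X, T Y >> p =
    << X, lie_endo phi xi a b Y >> p + k p * (H b Y p * H a X p - H a Y p * H b X p).
  rewrite /T /hlie_endo; move: (lie_endo phi xi a b Y) => U.
  by rewrite !(innerD, innerZ, innerN) (inner_reeb (acm a)) (inner_reeb (acm b)).
rewrite TE /split_pair /v (skew_formZr cstK d1_skew) (skew_formZ cstK d1_skew).
rewrite (wC (xi a) Y) (wC (xi b) Y) wab !wxa !wxb wE; field.
exact: kp.
Qed.

Let quaternionic_split : quaternionic (split_pair (xi a) v w) (fun X => F c X) (fun X => F b X).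
Proof.
have E (f h : Csmooth M) : f = - h -> f p = - h p by move=> ->.
have E' (f h : Csmooth M) : f = h -> f p = h p by move=> ->.
split=> X Y; rewrite !split_reeb /T -?mulrN; congr (_ * _); try apply: E; try apply: E'.
- exact: (hlie_endo_formc tqs lie_k abc).
- exact: (hlie_endo_formcc tqs lie_k abc).
- exact: (hlie_endo_formb tqs lie_k abc).
- exact: (hlie_endo_formbb tqs lie_k abc).
- by rewrite (hlie_endo_formcb tqs lie_k abc) (hlie_endo_formbc tqs lie_k abc).
Qed.

(** One plane from the Reeb fields and two per quaternionic line make an odd number: either 2l + 1
    planes split off, or fewer than 2l exhaust the form. *)
Lemma d1_reduces l : exists k' w', [/\ reduces k'.+1 w w' & ((k' = l.*2)%N \/
  [/\ (k'.+1 < l.*2)%N & forall X Y, w' X Y = 0])].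
Proof.
have [[w' r]|[l' [w' [l'l r w'0]]]] := reduces_quaternionic cstK l
    (skew_form_split d1_skew (xi a) v) quaternionic_split.
  by exists l.*2, w'; split; [exact: reducesS r|left].
exists l'.*2, w'; split; first exact: reducesS r.
by right; split=> //; lia.
Qed.

End Rank.

Lemma kform_d1E (R : realType) (m : nat) (M : smoothManifold R m) (eta : one_form M) :
  kform_d1 eta = (fun X q => d1 eta (X 0) (X 1) q).
Proof. by []. Qed.

(** Each term of [s] yields two functionals and two signed products; the boolean tells which
    functional receives the first vector. *)
Lemma expandable_of_seq (R : realType) (m : nat) (M : smoothManifold R m) (p : M)
    (w : vfield M -> vfield M -> M -> R) (s : seq ((vfield M -> R) * (vfield M -> R))) :
  (forall x y, w x y p = \sum_(ab <- s) (ab.1 x * ab.2 y - ab.2 x * ab.1 y)) ->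
  expandable p (fun ib : 'I_(size s) * bool =>
      let ab := tnth (in_tuple s) ib.1 in if ib.2 then ab.1 else ab.2)
    ((fun X q => w (X 0) (X 1) q) : kform M 2).
Proof.
move=> E; set Q := fun _ => _.
pose F (ib : 'I_(size s) * bool) (j : 'I_2) := (ib.1, if j == 0 then ib.2 else ~~ ib.2).
exists ('I_(size s) * bool)%type, (fun ib => (-1) ^+ (~~ ib.2)), F => X.
rewrite -(pair_bigA _ (fun i b => (-1) ^+ (~~ b) * \prod_j Q (F (i, b) j) (X j))) /=.
rewrite E [LHS]big_tnth; apply: eq_bigr => i _.
rewrite big_bool !big_ord_recl !big_ord0 /Q /F /= (_ : lift ord0 ord0 = 1); last exact/val_inj.
by rewrite expr0 expr1 !mul1r !mulr1 mulN1r.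
Qed.

Lemma three_rank_commuting (R : realType) (n l : nat) (M : smoothManifold R (4 * n + 3))
    (phi : 'I_3 -> endo_field M) (xi : 'I_3 -> vfield M)
    (eta : 'I_3 -> one_form M) (g : riem_metric M) :
  three_quasi_sasakian phi xi eta g -> three_rank eta (4 * l + 1)%N ->
  forall a b, lie (xi a) (xi b) = 0.
Proof.
move=> tqs rk; have c1 : cyc 0 1 2 by []; have [k [k01 k12 k20]] := lie_reebs tqs c1.
have lie_k a b c : cyc a b c -> lie (xi a) (xi b) = k *: xi c.
  by rewrite /cyc !inE => /or3P[] /eqP[-> -> ->].
suff k0 : k = 0.
  move=> a b; have /or3P[/eqP->||] := cyc_pair a b; first exact: liexx.
    by move/lie_k => ->; rewrite k0 scale0r.
  by rewrite lieC => /lie_k ->; rewrite k0 scale0r oppr0.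
apply: CsmoothP => p; apply/eqP/negPn/negP => kp.
have [q [rq nz z]] := rk 2; have {rq} ql : q = l.*2 by lia.
subst q.
have sk := d1_skew tqs p c1.
pose cst_smooth (a : R) : Csmooth M := mkCsmooth (@smooth_cst R _ M a).
have cstK : cancel cst_smooth (fun f : Csmooth M => f p) by [].
have [k' [w' [r [k'E|[k'l w'0]]]]] := d1_reduces tqs c1 lie_k kp l.
  (* A symplectic system of 2l + 1 pairs makes the power 2l + 1 of d eta positive, whereas the rank
     makes it vanish. *)
  have [e eE] := reduces_std cstK sk r.
  have := @wedge_pow_std R _ M p (d1 (eta 2)) sk.1 k'.+1 (fun i => e i)
    (fun i j => eE i j (ltn_ord i) (ltn_ord j)).
  by rewrite k'E -kform_d1E z ltxx.
(* Fewer than 2l planes mean fewer than 4l functionals, so the power 2l of d eta vanishes at [p],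
   against the rank. *)
have [s ss sE] := reduces_rank sk r w'0.
have [X] := nz p; apply; rewrite /wedge big1 ?mulr0 // => t _.
rewrite [X in _ * X](_ : _ = 0) ?mulr0 //.
have ex := expandable_of_seq sE.
rewrite kform_d1E; apply: (wedge_pow_eq0 _ ex).
rewrite card_prod card_ord card_bool ss; lia.
Qed.

Theorem theorem3p7 (R : realType) (n l : nat) (M : smoothManifold R (4 * n + 3))
    (phi : 'I_3 -> endo_field M) (xi : 'I_3 -> vfield M)
    (eta : 'I_3 -> one_form M) (g : riem_metric M) :
  three_quasi_sasakian phi xi eta g ->
  (l <= n)%N ->
  three_rank eta (4 * l + 1)%N ->
  three_cosymplectic phi xi eta g.
Proof.
move=> tqs _ rk; have comm := three_rank_commuting tqs rk.
have cos a b c (abc : cyc a b c) : cosymplectic (phi c) (xi c) (eta c) g.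
  have [acm nrm cl] := tqs.2 c; split=> // X Y p.
  by rewrite d1E (dform_commuting tqs comm _ _ abc) mulr0.
split; first exact: tqs.1.
by move=> c; have [a [b abc]] := cyc_ex c; exact: cos abc.
Qed.
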